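(* Let $k$ be a field, let $B$ be a standard graded artinian $k$-algebra with socle degree $s$, let $d\geq 1$, and set $A=B\otimes_k k[x]/(x^d)$. Let $i,t\geq 0$ be integers. Assume that the characteristic of $k$ is either zero or a prime which does not divide $$\prod_{p=\max\{1,d-i,i+t-s+1\}}^{\min\{d-1,t-1\}}\det(C_{t,p,d}),$$ where $C_{t,p,d}$ is the $(d-p)\times(d-p)$ integer matrix $$C_{t,p,d}=\begin{pmatrix}\binom{t}{d-1}&\binom{t}{d-2}&\cdots&\binom{t}{p}\\ \binom{t}{d-2}&\binom{t}{d-3}&\cdots&\binom{t}{p-1}\\ \vdots&\vdots&&\vdots\\ \binom{t}{p}&\binom{t}{p-1}&\cdots&\binom{t}{2p-(d-1)}\end{pmatrix}.$$ If $\overline{\ell}$ is a general linear form in $B$ and $\ell=\overline{\ell}+x$ is a general linear form in $A$, then the map $\cdot\ell^t:A_i\to A_{i+t}$ has full rank if and only if the maps $$\cdot\overline{\ell}^{\,2q+t-(d-1)}:B_{i-q}\to B_{i+q+t-(d-1)}$$ have full rank for the same reason for $q$ from $\max\{0,d-t\}$ to $d-1$. Moreover, if the matrices $\overline{M}_{i-q}^{2q+t-(d-1)}$ representing these maps for $q$ going from $\max\{0,d-t\}$ to $\min\{d-1,d-1-i-t+s,i\}$ and the matrix $M$ representing $\cdot\ell^t:A_i\to A_{i+t}$ are all square, then $|\det(M)|=F_1\cdot F_2\cdot F_3$, where $$F_1=\prod_{q=\max\{0,d-t\}}^{\min\{d-1,d-1-i-t+s,i\}}|\det(\overline{M}_{i-q}^{2q+t-(d-1)})|,$$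 $$F_2=\prod_{p=\max\{1,1+i+t-s,d-i-1\}}^{\min\{d-1,t-1\}}|\det(C_{t,p,d})|^{\dim_k(B_{i+p-(d-1)})-\dim_k(B_{i+p-d})},$$ and $$F_3=|\det(C_{t,i+t-s,d})|^{\dim_k(B_{2i-(d-1)+t-s})}\quad\text{if }\min\{d-1,t-1\}\geq i+t-s\geq\max\{0,(d-1)-i\},$$ while $F_3=1$ otherwise.
   Context: A standard graded artinian $k$-algebra $B$ is a finite-dimensional quotient of a polynomial ring over $k$ (all variables of degree $1$) by a homogeneous ideal; $B_j$ is its degree $j$ component ($B_j=0$ for $j<0$), and its socle degree $s$ is the largest degree with $B_s\neq 0$. The variable $x$ does not appear in $B$ and has degree $1$. A linear map has full rank if it is injective or surjective; a family of linear maps has full rank for the same reason if either all of them are injective or all of them are surjective. ''General linear form of $B$'' means a linear form in a suitable nonempty Zariski-open subset of $B_1$; after rescaling $x$, a general linear form of $A$ has the form $\ell=\overline{\ell}+x$ with $\overline{\ell}$ general in $B_1$. Matrices: fix a basis $\mathcal{B}_j$ of each $B_j$, and use for $A_j$ the basis $\bigsqcup_{r=0}^{d-1}x^r\mathcal{B}_{j-r}$. $\overline{M}_j^{a}$ is the matrix of $\cdot\overline{\ell}^{\,a}:B_j\to B_{j+a}$ and $M$ that of $\cdot\ell^t:A_i\to A_{i+t}$ in these bases. Binomial coefficients $\binom{t}{j}$ are $0$ for $j<0$ or $j>t$. The absolute values mean that the determinant identity (an identity in $k$) holds up to sign. Empty products are $1$, and the determinant of an empty matrix is $1$.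
   Formalization: The ''if'' direction (maps of B full rank for the same reason ⇒ full rank on A) also assumes det C_{t,p0,d} ≠ 0 in k for p0 = max{d-i-1, i+t-s} when 1 ≤ p0 ≤ min{d-1,t-1}; as printed it fails for char 2, B = k[y]/(y^2), d = t = 2, i = 0. *)

(* Defs.v *)
From HB Require Import structures.
From mathcomp Require Import all_boot all_order all_algebra.
From mathcomp Require Import qpoly falgebra.
From mathcomp Require Import mpoly.

Set Implicit Arguments.
Unset Strict Implicit.
Unset Printing Implicit Defensive.

Import GRing.Theory.
Local Open Scope ring_scope.

#[short(type="comFalgType")]
HB.structure Definition ComFalgebra (R : nzRingType) :=
  { A of Falgebra R A & GRing.ComUnitAlgebra R A }.

(* The quotient of k[x_1, ..., x_n] by a homogeneous ideal is given by its
   projection: the ideal is the kernel of [sga_pres].  A [comFalgType] is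
   finite-dimensional and nonzero, so the socle degree makes sense. *)
Record stdGradedArtinian (k : fieldType) := StdGradedArtinian {
  sga_sort :> comFalgType k;
  sga_nvars : nat;
  sga_pres : {lrmorphism {mpoly k[sga_nvars]} -> sga_sort};
  sga_surj : forall b : sga_sort, exists p, sga_pres p = b;
  sga_homog : forall p j, sga_pres p = 0 -> sga_pres (pihomog mdeg j p) = 0
}.

Section GradedAlgebra.
Variables (k : fieldType) (B : stdGradedArtinian k).
Local Notation n := (sga_nvars B).

Definition grn (j : nat) : {vspace B} :=
  (\sum_(m : 'X_{1..n < j.+1} | mdeg m == j) <[sga_pres B 'X_[m]]>)%VS.

Lemma grnP (j : nat) (b : B) :
  reflect (exists2 p : {mpoly k[n]}, p \is j.-homog & sga_pres B p = b)
          (b \in grn j).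
Proof.
apply: (iffP idP) => [|[p hp <-]].
  case/memv_sumP => v hv ->.
  pose c (m : 'X_{1..n < j.+1}) := coord [tuple sga_pres B 'X_[m]] ord0 (v m).
  exists (\sum_(m : 'X_{1..n < j.+1} | mdeg m == j) c m *: 'X_[m]).
    by apply: rpred_sum => m hm; apply: rpredZ; rewrite dhomogX.
  rewrite raddf_sum; apply: eq_bigr => m hm; rewrite /= linearZ /= /c.
  have := hv m hm; rewrite -span_seq1 => /coord_span {2}->.
  by rewrite big_ord1.
rewrite -(pihomog_dE hp) (pihomogwE mdeg _ (k := maxn (msize p) j.+1)); last first.
  by rewrite leq_maxl.
rewrite raddf_sum; apply: memv_suml => m hm; rewrite /= linearZ /=.
apply: memvZ; have jm : (mdeg m < j.+1)%N by rewrite (eqP hm).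
apply: (subvP (sumv_sup (BMultinom jm) _ (subvv _))) => //.
exact: memv_line.
Qed.

Definition gr (j : int) : {vspace B} := if j is Posz m then grn m else 0%VS.

Definition is_socle_degree (s : nat) : Prop :=
  grn s != 0%VS /\ (forall j, (s < j)%N -> grn j = 0%VS).

Definition zariski_open (V : {vspace B}) (U : B -> Prop) : Prop :=
  exists F : {mpoly k[\dim V]} -> Prop, forall v, v \in V ->
    (U v <-> exists2 f, F f & f.@[fun u => coord (vbasis V) u v] != 0).

Definition for_general (V : {vspace B}) (P : B -> Prop) : Prop :=
  exists U : B -> Prop,
    [/\ zariski_open V U,
        exists2 v, v \in V & U v
      & forall v, v \in V -> U v -> P v].

End GradedAlgebra.

Section Rank.
Variables T1 T2 : Type.
Implicit Types (D : {pred T1}) (E : {pred T2}) (f : T1 -> T2).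

Definition inj_on D f : Prop := {in D &, injective f}.

Definition surj_on D E f : Prop :=
  forall w, w \in E -> exists2 v, v \in D & f v = w.

Definition full_rank D E f : Prop := inj_on D f \/ surj_on D E f.

End Rank.

Section Tensor.
Variables (k : fieldType) (B : stdGradedArtinian k) (d : nat).

(* B (x)_k k[x]/(x^d) as B[x]/(x^d); the class of a polynomial is represented
   by its remainder modulo x^d.  For d = 0, which is always excluded,
   [{poly %/ _}] would be the quotient by x instead. *)
Definition tens : comNzRingType := {poly %/ ('X^d : {poly B})}.

Definition xcoef (a : tens) (r : nat) : B :=
  ((a : {poly %/ ('X^d : {poly B})}) : {poly B})`_r.

Definition tvar : tens := qpolyX 'X^d.

Definition tinc (b : B) : tens := qpolyC 'X^d b.

Definition tgr (j : int) : {pred tens} :=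
  [pred a | [forall r : 'I_d, xcoef a r \in gr B (j - r%:Z)]].

Lemma xcoefM (a b : tens) (r : nat) : (r < d)%N ->
  xcoef (a * b) r = \sum_(u < r.+1) xcoef a u * xcoef b (r - u).
Proof.
move=> rd.
have E (p q : {poly B}) :
    (Pdiv.CommonRing.rmodp (p * q) (mk_monic 'X^d))`_r
      = \sum_(u < r.+1) p`_u * q`_(r - u).
  rewrite mk_monic_Xn prednK ?(leq_ltn_trans _ rd) //.
  by rewrite -Pdiv.RingMonic.take_poly_rmodp coef_take_poly rd coefM.
exact: E.
Qed.

End Tensor.

(* The matrices below act on column vectors of coordinates. *)
Section Matrices.
Variables (k : fieldType) (B : stdGradedArtinian k).
Variable bas : forall j : int, (\dim (gr B j)).-tuple B.

Definition Mbar (l : B) (j : int) (a : nat) :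
    'M[k]_(\dim (gr B (j + a%:Z)), \dim (gr B j)) :=
  \matrix_(u, v) coord (bas (j + a%:Z)) u (l ^+ a * tnth (bas j) v).

(* In the basis of A_j made of the x^r b with b in [bas (j - r)], the
   coordinates of an element are those of its x-coefficients. *)
Definition Mtens (d : nat) (l : tens B d) (i t : nat) :
    'M[k]_(\sum_(r' < d) \dim (gr B (i%:Z + t%:Z - r'%:Z)),
           \sum_(r < d) \dim (gr B (i%:Z - r%:Z))) :=
  \mxblock_(r' < d, r < d)
    \matrix_(u, v) coord (bas (i%:Z + t%:Z - r'%:Z)) u
      (xcoef (l ^+ t * (tvar B d ^+ r * tinc d (tnth (bas (i%:Z - r%:Z)) v))) r').

End Matrices.

(* The determinant of a matrix whose two dimensions are only propositionally
   equal; it is meant to be used on square matrices only. *)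
Definition sqdet (R : comNzRingType) (m n : nat) (M : 'M[R]_(m, n)) : R :=
  \det (conform_mx (0 : 'M_n) M).

Definition binz (t : nat) (j : int) : nat := if j is Posz m then 'C(t, m) else 0.

Definition Cmx (t p d : nat) : 'M[int]_(d - p) :=
  \matrix_(a, b) (binz t (d%:Z - 1 - a%:Z - b%:Z))%:Z.

(* It is not enough that the product of the det C_{t,p,d} over
   max(1, d-i, i+t-s+1) <= p <= min(d-1, t-1) be nonzero in k for the maps
   between components of B to control the one between components of A: for k
   infinite of characteristic 2, B = k[y]/(y^2), d = t = 2 and i = 0, that
   product is empty and all the maps of B involved are injective, whereas
   (c y + x)^2 = 2 c x y = 0 is the zero map between the nonzero spaces A_0 and
   A_2.  The factor one step below that range is needed as well; in
   characteristic zero it is nonzero. *)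
Definition boundary_ok (k : fieldType) (s d i t : nat) : Prop :=
  let p0 := maxn (d - (i + 1)) (i + t - s) in
  (0 < p0 < minn d t)%N -> (\det (Cmx t p0 d))%:~R != 0 :> k.

(* Main.v *)
Require Import Defs.
From Stdlib Require Import FunctionalExtensionality.
From mathcomp Require Import all_boot all_order all_algebra.
From mathcomp Require Import perm qpoly falgebra mpoly.
From mathcomp Require Import zify ring.

(* Write y for the linear form of B.  Up to the order of the rows, the map
   A_i -> A_(i+t) is a d x d block matrix whose block (q, b) is c_qb times the
   multiplication by y^(rho q - gam b) from degree gam b to degree rho q, where
   C = (c_qb) is a matrix of binomial coefficients.  The degrees are monotone in
   such a way that the unitriangular factors of an LU decomposition of C can be
   homogenized too, with nonnegative powers of y only.  So the block matrix
   becomes diagonal, with blocks c_q y^(2q+t-(d-1)), where c_q = m_(q+1) / m_q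
   and m_q = +- det C_(t,d-q,d) is the leading minor of size q of C; the maps
   with q < d - t become identities.  Comparing ranks gives the equivalence, and
   the product of the c_q^(dim B_(i-q)) telescopes to F_2 F_3.  Beyond the last
   pivot all the source components or all the target components vanish.

   In characteristic zero det C_(t,p,d) is nonzero because a nonzero multiple of
   (X + 1)^t has more than t terms. *)

Set Implicit Arguments.
Unset Strict Implicit.
Unset Printing Implicit Defensive.

Import Order.TTheory GRing.Theory Num.Theory.
Local Open Scope ring_scope.

(** * Binomial determinants in characteristic zero *)

Definition nterms (p : {poly rat}) : nat := count (fun c => c != 0) p.

Lemma nterms_iota (r : {poly rat}) (N : nat) : (size r <= N)%N ->
  nterms r = count (fun i => r`_i != 0) (iota 0 N).
Proof.
move=> rN; rewrite -(subnKC rN) iotaD count_cat /nterms.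
rewrite [X in (_ + X)%N](@eq_in_count _ _ pred0) ?count_pred0 ?addn0.
  by rewrite -[X in count _ X](mkseq_nth 0) /mkseq count_map; apply: eq_count.
by move=> i; rewrite mem_iota add0n => /andP[ri _]; rewrite nth_default ?eqxx.
Qed.

(* Differentiating lowers the multiplicity by one and kills the constant term. *)
Lemma dvdp_X1exp_nterms (n : nat) (p : {poly rat}) :
  ('X + 1) ^+ n %| p -> (nterms p <= n)%N -> p = 0.
Proof.
have [m] := ubnP (size p); elim: m n p => // m IHm n p.
case: (eqVneq p 0) => // p0 sp dvd cnt.
have [q [c pE]] : exists (q : {poly rat}) c, p = q * 'X + c%:P.
  elim/poly_ind: p {p0 sp dvd cnt} => [|q c _]; last by exists q, c.
  by exists 0, 0; rewrite mul0r add0r.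
have ntE : nterms p = (nterms q + (c != 0%R))%N.
  rewrite pE -cons_poly_def /nterms polyseq_cons.
  case: (@nilP _ q) => [->|_] /=; last by rewrite addnC.
  by rewrite polyseqC; case: (eqVneq c 0) => //= ->.
(* Without constant term, ['X] can be divided out: it is coprime to ['X + 1], so the divisibility
   persists, with the same number of terms and a smaller size. *)
case: (eqVneq c 0) => c0.
  have q0 : q != 0 by apply: contraNneq p0 => q0; rewrite pE q0 c0 mul0r addr0.
  suff q0' : q = 0 by rewrite q0' eqxx in q0.
  apply: (IHm n).
  - by move: sp; rewrite pE c0 addr0 size_mulX.
  - move: dvd; rewrite pE c0 addr0 Gauss_dvdpl //.
    apply: coprimep_expl; apply/Bezout_coprimepP; exists (1, -1) => /=.
    by rewrite mul1r mulN1r addrAC subrr add0r eqpxx.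
  - by move: cnt; rewrite ntE c0 eqxx addn0.
case: n dvd cnt => [|n] dvd cnt; first by rewrite ntE c0 addn1 in cnt.
have pos (i : nat) : (p^`()`_i != 0) = (q`_i != 0).
  rewrite coef_deriv pE coefD coefMX coefC /= addr0.
  by rewrite -mulr_natr mulf_eq0 pnatr_eq0 orbF.
have nt' : nterms p^`() = nterms q.
  rewrite (@nterms_iota _ (maxn (size p^`()) (size q))) ?leq_maxl //.
  rewrite (@nterms_iota q (maxn (size p^`()) (size q))) ?leq_maxr //.
  exact: eq_count.
have d0 : p^`() = 0.
  apply: (IHm n).
  - exact: leq_trans (lt_size_deriv p0) _.
  - case/dvdpP: dvd => r ->; rewrite derivM deriv_exp /=.
    apply: dvdp_add; first by rewrite exprS mulrA dvdp_mull.
    by rewrite -mulr_natl !mulrA dvdp_mull.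
  - by rewrite nt'; move: cnt; rewrite ntE c0 addn1.
have q0 : q = 0.
  by apply/polyP => i; rewrite coef0; apply/eqP/negbNE; rewrite -pos d0 coef0 eqxx.
(* Now [p] is a nonzero constant, too small to be divisible by a positive power of ['X + 1]. *)
move: dvd; rewrite pE q0 mul0r add0r => /dvdp_leq; rewrite polyC_eq0 c0.
move=> /(_ isT); rewrite size_polyC c0 -[1]opprK -(rmorph1 (@polyC rat)) -polyCN.
by rewrite size_exp_XsubC.
Qed.

(* A vector in the kernel of [Cmx t p d] is the list of coefficients of a [V] of
   degree less than d - p such that (X + 1)^t V has no term of degree in [p, d);
   that product then has at most t terms. *)
Lemma det_Cmx_neq0 (t p d : nat) : (p <= t)%N -> \det (Cmx t p d) != 0.
Proof.
move=> pt; have [dp|pd] := leqP d p.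
  have e : (d - p = 0)%N by lia.
  by move: (Cmx t p d); rewrite e => M; rewrite det_mx00.
rewrite -(intr_eq0 rat) -det_map_mx; apply/det0P => -[v v0 vC].
pose V := \sum_(a < d - p) v 0 a *: 'X^a.
have V_coef (j : nat) : V`_j = if insub j is Some a then v 0 a else 0.
  rewrite coef_sum; case: insubP => [a _ <-|].
    rewrite (bigD1 a) //= big1 ?addr0 ?coefZ ?coefXn ?eqxx ?mulr1 // => b ba.
    rewrite coefZ coefXn; case: eqP => [/val_inj e|]; last by rewrite mulr0.
    by rewrite e eqxx in ba.
  move=> nj; rewrite big1 // => b _; rewrite coefZ coefXn.
  by case: eqP => [e|_]; [rewrite e ltn_ord in nj | rewrite mulr0].
have W_coef (j : nat) : (('X + 1) ^+ t * V)`_j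
    = \sum_(a < d - p) v 0 a * (binz t (j%:Z - a%:Z))%:R.
  rewrite mulr_sumr coef_sum; apply: eq_bigr => a _.
  rewrite -scalerAr coefZ; congr (_ * _).
  rewrite coefMXn; case: ltnP => ja.
    by case E : (j%:Z - a%:Z) => [m|] //=; lia.
  have -> : j%:Z - a%:Z = (j - a)%N by lia.
  rewrite exprDn coef_sum /=.
  have [le|lt] := leqP (j - a) t.
    have lt' : (t - (j - a) < t.+1)%N by lia.
    rewrite (bigD1 (Ordinal lt')) //= big1 ?addr0.
      by rewrite expr1n mulr1 coefMn coefXn subKn // eqxx bin_sub.
    move=> b hb; rewrite expr1n mulr1 coefMn coefXn.
    case: eqP => [e|]; last by rewrite mul0rn.
    case/eqP: hb; apply/val_inj => /=; have := ltn_ord b; lia.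
  rewrite bin_small // big1 // => b _; rewrite expr1n mulr1 coefMn coefXn.
  by case: eqP => [e|]; rewrite ?mul0rn //; lia.
have W0 (j : nat) : (p <= j < d)%N -> (('X + 1) ^+ t * V)`_j = 0.
  move=> hj; rewrite W_coef.
  (* Column [d - 1 - j] of [Cmx t p d] has the entries C(t, j - a). *)
  have lt : (d - 1 - j < d - p)%N by lia.
  have := congr1 (fun M : 'rV__ => M 0 (Ordinal lt)) vC.
  rewrite !mxE => e; apply: etrans e; apply: eq_bigr => a _.
  rewrite !mxE /= -pmulrn; congr (_ * (binz _ _)%:R); lia.
have VW : ('X + 1) ^+ t * V = 0.
  apply: (@dvdp_X1exp_nterms t); first exact: dvdp_mulr.
  have sV : (size V <= d - p)%N.
    by apply/leq_sizeP => j hj; rewrite V_coef insubF // ltnNge hj.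
  have sW : (size (('X + 1%R) ^+ t * V)%R <= p + ((d - p) + (t - p)))%N.
    apply: leq_trans (size_polyMleq _ _) _.
    rewrite -[1]opprK -(rmorph1 (@polyC rat)) -polyCN size_exp_XsubC; lia.
  (* The degrees are cut into [p], then [d - p], then [t - p] consecutive ones. The middle range is
     [p, d), where all coefficients vanish, so at most p + (t - p) = t terms remain. *)
  rewrite (nterms_iota sW) iotaD count_cat iotaD count_cat.
  rewrite [X in (_ + (X + _))%N](@eq_in_count _ _ pred0) ?count_pred0.
    apply: leq_trans (leq_add (count_size _ _) (leq_add (leqnn 0) (count_size _ _))) _.
    by rewrite !size_iota add0n subnKC.
  by move=> j; rewrite mem_iota => hj; rewrite W0 ?eqxx //; lia.
have V0 : V = 0.
  by move/eqP: VW; rewrite mulf_eq0 expf_eq0 -size_poly_eq0 size_XaddC andbF => /eqP.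
case/eqP: v0; apply/rowP => a; rewrite mxE.
by have := V_coef a; rewrite V0 coef0 valK.
Qed.

(** * Graded LU decomposition *)

Definition unitrig (R : pzSemiRingType) (d : nat) (L : 'M[R]_d) : Prop :=
  (forall a b : 'I_d, (a < b)%N -> L a b = 0) /\ (forall a, L a a = 1).

Definition lead (R : Type) (m d : nat) (md : (m <= d)%N) (X : 'M[R]_d) : 'M[R]_m :=
  mxsub (widen_ord md) (widen_ord md) X.

(* The block of [X] at (a, b) is meant to carry the power rho a - gam b of a
   linear form, see [homog_mx]. *)
Definition supported (R : nmodType) (d : nat) (rho gam : 'I_d -> int)
    (X : 'M[R]_d) : Prop :=
  forall a b, X a b != 0 -> gam b <= rho a.

Section Unitriangular.
Variables (R : comPzRingType) (d : nat).
Implicit Types X L U : 'M[R]_d.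

Lemma unitrig1 : unitrig (1%:M : 'M[R]_d).
Proof.
split=> [a b ab|a]; rewrite mxE ?eqxx //.
by case: eqP => // e; rewrite e ltnn in ab.
Qed.

Lemma unitrigM X Y : unitrig X -> unitrig Y -> unitrig (X *m Y).
Proof.
move=> [X0 X1] [Y0 Y1]; split=> [a b ab|a]; rewrite mxE.
  rewrite big1 // => c _; have [ac|ca] := ltnP a c; first by rewrite X0 ?mul0r.
  by rewrite Y0 ?mulr0 ?(leq_ltn_trans ca).
rewrite (bigD1 a) //= X1 Y1 mulr1 big1 ?addr0 // => c ca.
have [ac|] := ltnP a c; first by rewrite X0 ?mul0r.
by rewrite leq_eqVlt val_eqE (negPf ca) /= => /Y0 ->; rewrite mulr0.
Qed.

Lemma det_unitrig X : unitrig X -> \det X = 1.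
Proof.
move=> [X0 X1]; rewrite det_trig; first by rewrite big1.
by apply/is_trig_mxP.
Qed.

End Unitriangular.

Section Lead.
Variables (R : comPzRingType) (d m : nat) (md : (m <= d)%N).
Implicit Types X L U : 'M[R]_d.

Lemma unitrig_lead X : unitrig X -> unitrig (lead md X).
Proof. by move=> [X0 X1]; split=> [a b ab|a]; rewrite mxE; [apply: X0|apply: X1]. Qed.

(** The first m rows of a lower triangular matrix vanish outside the first m columns. *)
Lemma lead_mull L X : unitrig L -> lead md (L *m X) = lead md L *m lead md X.
Proof.
move=> [L0 _]; apply/matrixP => a b; rewrite !mxE.
rewrite [LHS](bigID (fun c : 'I_d => (c < m)%N)) /= [X in _ + X]big1 ?addr0.
  rewrite (big_ord_narrow md); by apply: eq_bigr => c _; rewrite !mxE.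
move=> c; rewrite -leqNgt => mc; rewrite L0 ?mul0r //=.
exact: leq_trans (ltn_ord a) mc.
Qed.

Lemma tr_lead X : (lead md X)^T = lead md X^T.
Proof. by apply/matrixP => a b; rewrite !mxE. Qed.

(** Because of this invariance, the pivots produced by elimination are governed by the leading
    minors of the original matrix. *)
Lemma det_lead_LU L U X : unitrig L -> unitrig U^T ->
  \det (lead md (L *m X *m U)) = \det (lead md X).
Proof.
move=> uL uU; rewrite -mulmxA lead_mull // det_mulmx.
rewrite (det_unitrig (unitrig_lead uL)) mul1r.
rewrite -det_tr tr_lead trmx_mul lead_mull // det_mulmx.
by rewrite (det_unitrig (unitrig_lead uU)) mul1r -tr_lead det_tr.
Qed.

End Lead.

Section Support.
Variables (R : pzSemiRingType) (d : nat).

Lemma supportedM (rho gam del : 'I_d -> int) (X Y : 'M[R]_d) :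
  supported rho gam X -> supported gam del Y -> supported rho del (X *m Y).
Proof.
move=> sX sY a b; rewrite mxE.
case: (boolP [exists c, X a c * Y c b != 0]) => [/existsP[c Xc] _|].
  have X0 : X a c != 0 by apply: contraNneq Xc => ->; rewrite mul0r.
  have Y0 : Y c b != 0 by apply: contraNneq Xc => ->; rewrite mulr0.
  exact: le_trans (sY _ _ Y0) (sX _ _ X0).
rewrite negb_exists => /forallP h; rewrite big1 ?eqxx // => c _.
by apply/eqP; have := h c; rewrite negbK.
Qed.

Lemma supported1 (rho : 'I_d -> int) : supported rho rho (1%:M : 'M[R]_d).
Proof. by move=> a b; rewrite mxE; case: (a =P b) => [->|_]; rewrite ?eqxx. Qed.

End Support.

Section Elimination.
Variables (k : fieldType) (d : nat).
Implicit Types X L U : 'M[k]_d.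

Definition eliminated (n : nat) X : Prop :=
  forall a b : 'I_d, (a < n)%N || (b < n)%N -> a != b -> X a b = 0.

(** A Gauss transformation: multiplying by it on the left adds [c a] times row [n] to each row [a]
    below. *)
Definition transvection_col (n : 'I_d) (c : 'I_d -> k) : 'M[k]_d :=
  1%:M + \matrix_(a, b) if (n < a)%N && (b == n) then c a else 0.

Lemma transvection_mul n (c : 'I_d -> k) X a b :
  (transvection_col n c *m X) a b = X a b + (if (n < a)%N then c a * X n b else 0).
Proof.
rewrite mulmxDl mul1mx mxE; congr (_ + _); rewrite mxE (bigD1 n) //= mxE eqxx andbT.
rewrite big1 ?addr0; first by case: ifP; rewrite ?mul0r.
by move=> e en; rewrite mxE (negPf en) andbF mul0r.
Qed.

Lemma unitrig_transvection n c : unitrig (transvection_col n c).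
Proof.
split=> [a b ab|a]; rewrite !mxE.
  case: eqP => [e|_]; first by rewrite e ltnn in ab.
  case: ifP; rewrite ?addr0 // => /andP[na /eqP e].
  by move: (ltn_trans na ab); rewrite e ltnn.
by rewrite eqxx; case: ifP; rewrite ?addr0 // => /andP[na /eqP e]; rewrite e ltnn in na.
Qed.

Lemma transvectionK n (c : 'I_d -> k) :
  transvection_col n c *m transvection_col n (fun a => - c a) = 1%:M.
Proof.
apply/matrixP => a b; rewrite transvection_mul 3!mxE.
have -> : transvection_col n (fun a => - c a) n b = (n == b)%:R.
  by rewrite !mxE ltnn /= addr0.
rewrite [b == n]eq_sym; case: ltnP => na; rewrite /= ?addr0 //.
by case: (n == b); rewrite ?mulr0 ?mulr1 ?addr0 ?addrNK ?addr0 // mxE addrNK.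
Qed.

Lemma supported_transvection (n : 'I_d) (c : 'I_d -> k) (rho : 'I_d -> int) :
  (forall a : 'I_d, (n < a)%N -> c a != 0 -> rho n <= rho a) ->
  supported rho rho (transvection_col n c).
Proof.
move=> h a b; rewrite !mxE; case: (a =P b) => [->//|_]; rewrite add0r.
by case: ifP => [/andP[na /eqP->]|]; [exact: h|rewrite eqxx].
Qed.

(** The inverses come with their supports, so that they can be homogenized as well and the factors
    stay invertible over [B]. *)
Record graded_LU (rho gam : 'I_d -> int) L U : Prop := GradedLU {
  LU_L : unitrig L;
  LU_U : unitrig U^T;
  LU_sL : supported rho rho L;
  LU_sU : supported gam gam U;
  LU_Linv : exists2 L', L *m L' = 1%:M & supported rho rho L';
  LU_Uinv : exists2 U', U' *m U = 1%:M & supported gam gam U' }.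

Lemma graded_LU1 rho gam : graded_LU rho gam 1%:M 1%:M.
Proof.
split; rewrite ?trmx1; try exact: unitrig1; try exact: supported1.
all: by exists 1%:M; rewrite ?mulmx1 //; apply: supported1.
Qed.

Lemma graded_LUM rho gam L U L1 U1 : graded_LU rho gam L U ->
  graded_LU rho gam L1 U1 -> graded_LU rho gam (L1 *m L) (U *m U1).
Proof.
move=> [uL uU sL sU [L' LL' sL'] [U' UU' sU']].
move=> [uL1 uU1 sL1 sU1 [L1' LL1' sL1'] [U1' UU1' sU1']]; split.
- exact: unitrigM.
- by rewrite trmx_mul; apply: unitrigM.
- exact: supportedM sL1 sL.
- exact: supportedM sU sU1.
- exists (L' *m L1'); last exact: supportedM sL' sL1'.
  by rewrite mulmxA -(mulmxA L1) LL' mulmx1.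
- exists (U1' *m U'); last exact: supportedM sU1' sU'.
  by rewrite mulmxA -(mulmxA U1') UU' mulmx1.
Qed.

(** Column operations to the right are always allowed, since [gam] is antitone. Row [n] may be added
    to row [a] only if [rho n <= rho a]; when only [rho n <= gam n] is known, a nonzero entry
    [X a n] gives [gam n <= rho a]. *)
Lemma eliminate_step (rho gam : 'I_d -> int) (n : 'I_d) X :
  (forall a b : 'I_d, (a < b)%N -> gam b <= gam a) ->
  (forall a : 'I_d, (n < a)%N -> rho n <= gam n \/ rho n <= rho a) ->
  supported rho gam X -> eliminated n X -> X n n != 0 ->
  exists L U, graded_LU rho gam L U /\ eliminated n.+1 (L *m X *m U).
Proof.
move=> hgam hrho sX eX X0.
pose c a := - (X a n / X n n); pose e b := - (X n b / X n n).
exists (transvection_col n c), (transvection_col n e)^T; split.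
  have sc (a : 'I_d) : (n < a)%N -> c a != 0 -> rho n <= rho a.
    move=> na ca; case: (hrho a na) => // h; apply: le_trans h _; apply: sX.
    by apply: contraNneq ca => h; rewrite /c h mul0r oppr0.
  have sT (f : 'I_d -> k) : supported gam gam (transvection_col n f)^T.
    move=> a b; rewrite !mxE; case: (b =P a) => [->//|_]; rewrite add0r.
    by case: ifP => [/andP[nb /eqP->] _|]; [exact: hgam|rewrite eqxx].
  split; rewrite ?trmxK; try exact: unitrig_transvection.
  - exact: supported_transvection.
  - exact: sT.
  - exists (transvection_col n (fun a => - c a)); first exact: transvectionK.
    by apply: supported_transvection => a na; rewrite oppr_eq0; apply: sc.
  - exists (transvection_col n (fun a => - e a))^T; last exact: sT.
    by rewrite -trmx_mul transvectionK trmx1.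
move=> a b hab ab.
rewrite -[_ *m _]trmxK mxE trmx_mul trmxK transvection_mul.
rewrite ![(_^T) _ _]mxE !transvection_mul.
have Xan : a != n -> X a n + (if (n < a)%N then c a * X n n else 0) = 0.
  move=> an; have [na|na] := ltnP n a; first by rewrite /c mulNr divfK // addrN.
  by rewrite addr0; apply: eX => //; rewrite ltn_neqAle na val_eqE an.
have [na|an] := ltnP n a.
  have an : a != n by rewrite -val_eqE (gtn_eqF na).
  have [nb|bn] := ltnP n b.
    by case/orP: hab; rewrite ltnS leqNgt ?na ?nb.
  rewrite addr0; move: bn; rewrite leq_eqVlt => /predU1P[/val_inj ->|bn].
    by have := Xan an; rewrite na.
  by rewrite !eX ?bn ?orbT ?mulr0 ?addr0 // -val_eqE (gtn_eqF bn).
rewrite !addr0; move: an; rewrite leq_eqVlt => /predU1P[/val_inj e1|an].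
  rewrite e1; have [nb|bn] := ltnP n b; first by rewrite /e mulNr divfK // addrN.
  rewrite addr0 eX //; last by rewrite -e1.
  by rewrite ltnn ltn_neqAle bn val_eqE -e1 eq_sym ab orbT.
rewrite (eX a b) ?an // add0r; case: ifP => // nb.
by rewrite eX ?mulr0 ?an // -val_eqE (ltn_eqF an).
Qed.

Lemma det_lead_eliminated n X (nd : (n < d)%N) : eliminated n X ->
  \det (lead nd X) = \det (lead (ltnW nd) X) * X (Ordinal nd) (Ordinal nd).
Proof.
have diag m (md : (m <= d)%N) : (m <= n.+1)%N -> eliminated n X ->
    \det (lead md X) = \prod_(a < m) X (widen_ord md a) (widen_ord md a).
  move=> mn eX; rewrite det_trig; first by apply: eq_bigr => a _; rewrite mxE.
  apply/is_trig_mxP => a b ab; rewrite mxE eX //= -?val_eqE /= ?(ltn_eqF ab) //.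
  by rewrite (leq_trans ab) // -ltnS (leq_trans (ltn_ord b) mn).
move=> eX; rewrite !diag // big_ord_recr /=; congr (_ * X _ _); last 2 first.
- exact: val_inj.
- exact: val_inj.
by apply: eq_bigr => a _; congr (X _ _); apply: val_inj.
Qed.

(** Induction on [n]: the next pivot is a factor of the leading minor of size n + 1, which the
    previous steps have not changed, so it is nonzero. *)
Lemma graded_elimination (rho gam : 'I_d -> int) X (n : nat) :
  (forall a b : 'I_d, (a < b)%N -> gam b <= gam a) ->
  (forall a b : 'I_d, (b < n)%N -> (b < a)%N -> rho b <= gam b \/ rho b <= rho a) ->
  supported rho gam X -> (n <= d)%N ->
  (forall m (md : (m <= d)%N), (m <= n)%N -> \det (lead md X) != 0) ->
  exists L U, graded_LU rho gam L U /\ eliminated n (L *m X *m U).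
Proof.
move=> hgam; elim: n => [|n IHn] hrho sX nd hdet.
  by exists 1%:M, 1%:M; split; [exact: graded_LU1|].
have [a b bn|m md mn|L [U [hLU eD]]] := IHn _ sX (ltnW nd).
- by apply: hrho; apply: ltnW.
- by apply: hdet; apply: ltnW.
have D0 : (L *m X *m U) (Ordinal nd) (Ordinal nd) != 0.
  have := hdet _ nd (leqnn _); rewrite -(det_lead_LU nd X (LU_L hLU) (LU_U hLU)).
  by rewrite det_lead_eliminated // mulf_eq0 => /norP[].
have sD : supported rho gam (L *m X *m U).
  exact: supportedM (supportedM (LU_sL hLU) sX) (LU_sU hLU).
have [a na|L1 [U1 [hLU1 e1]]] := @eliminate_step rho gam (Ordinal nd) _ hgam _ sD eD D0.
  exact: hrho.
exists (L1 *m L), (U *m U1); split; first exact: graded_LUM.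
by rewrite !mulmxA in e1 *.
Qed.

End Elimination.

(** * Determinants of block matrices *)

Section SquareDeterminant.
Variable R : comNzRingType.

Lemma sqdetE n (M : 'M[R]_n) : sqdet M = \det M.
Proof. by rewrite /sqdet conform_mx_id. Qed.

Lemma sqdet_mul m n (L : 'M[R]_m) (M : 'M[R]_(m, n)) (U : 'M[R]_n) : m = n ->
  sqdet (L *m M *m U) = \det L * sqdet M * \det U.
Proof. by move=> e; case: _ / e M U => M U; rewrite !sqdetE !det_mulmx. Qed.

Lemma sqdetZ m n (c : R) (M : 'M[R]_(m, n)) : m = n ->
  sqdet (c *: M) = c ^+ n * sqdet M.
Proof. by move=> e; case: _ / e M => M; rewrite !sqdetE detZ. Qed.

(** Injections between index sets of equal size are permutations, and squaring removes their signs.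
    Identities up to sign are handled through squares from here on. *)
Lemma sqdet_mxsub_sqr m n m' n' (M : 'M[R]_(m, n)) (f : 'I_m' -> 'I_m)
    (g : 'I_n' -> 'I_n) : injective f -> injective g ->
  m' = m -> n' = n -> m = n -> sqdet (mxsub f g M) ^+ 2 = sqdet M ^+ 2.
Proof.
move=> + + em en e; case: _ / e M g en => M g en; case: _ / em M f g en => M f g en.
case: _ / (esym en) g => g fi gi; rewrite !sqdetE.
have -> : mxsub f g M = row_perm (perm fi) (col_perm (perm gi) M).
  by apply/matrixP => a b; rewrite !mxE !permE.
rewrite row_permE col_permE !det_mulmx !det_perm.
by rewrite !exprMn !sqrr_sign mul1r mulr1.
Qed.

Lemma det_mxdiag m (p : 'I_m -> nat) (B : forall i, 'M[R]_(p i)) :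
  \det (\mxdiag_i B i) = \prod_i \det (B i).
Proof.
elim: m p B => [|m IHm] p B.
  rewrite [RHS]big_ord0; move: (\mxdiag_i _); rewrite big_ord0 => M.
  exact: det_mx00.
rewrite mxdiag_recl [RHS]big_ord_recl -IHm; case: _ / mxsize_recl => /=.
by rewrite castmx_id det_ublock.
Qed.

Lemma sqdet_mxblock_diag d (p q : 'I_d -> nat)
    (B : forall a b, 'M[R]_(p a, q b)) :
  (forall a, p a = q a) -> (forall a b, a != b -> B a b = 0) ->
  sqdet (\mxblock_(a, b) B a b) = \prod_a sqdet (B a a).
Proof.
(* Extensionality makes the two size functions equal, so that after destructing the equality every
   diagonal block is square by its type. *)
move=> /functional_extensionality e; case: _ / e B => B B0.
rewrite sqdetE (_ : \mxblock_(a, b) B a b = \mxdiag_a B a a).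
  by rewrite det_mxdiag; apply: eq_bigr => a _; rewrite sqdetE.
apply: eq_mxblock => a b; case: (eqVneq a b) => [<-|/B0 //].
by rewrite conform_mx_id.
Qed.

Lemma det_mxblock_unitrig d (p : 'I_d -> nat) (B : forall a b, 'M[R]_(p a, p b)) :
  (forall a b : 'I_d, (a < b)%N -> B a b = 0) -> (forall a, B a a = 1%:M) ->
  \det (\mxblock_(a, b) B a b) = 1.
Proof.
move=> B0 B1; rewrite det_trig.
  by rewrite big1 // => s _; rewrite mxE B1 mxE eqxx.
by apply/is_trig_mxblockP; split=> // a; rewrite B1 scalar_mx_is_trig.
Qed.

Lemma sqdet_mxblock_rows_sqr d (p q : 'I_d -> nat)
    (B : forall a b, 'M[R]_(p a, q b)) (f : 'I_d -> 'I_d) : injective f ->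
  (\sum_a p a = \sum_a q a)%N ->
  sqdet (\mxblock_(a, b) B (f a) b) ^+ 2 = sqdet (\mxblock_(a, b) B a b) ^+ 2.
Proof.
move=> fi e.
(* [F] is the permutation of the scalar rows induced by the permutation [f] of the block rows. *)
pose F (s : 'I_(\sum_a p (f a))) : 'I_(\sum_a p a) :=
  tagnat.Rank (f (tagnat.sig1 s)) (tagnat.sig2 s).
have Fi : injective F.
  move=> s s' /(congr1 val)/eqP; rewrite tagnat.eq_Rank => /andP[/eqP/fi e1 e2].
  apply/val_inj/eqP; rewrite -[s]tagnat.sig2K -[s']tagnat.sig2K.
  by rewrite tagnat.eq_Rank; apply/andP; split; [apply/eqP|].
have -> : \mxblock_(a, b) B (f a) b = mxsub F id (\mxblock_(a, b) B a b).
  apply/matrixP => s u; rewrite mxE [RHS]mxE.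
  rewrite -[X in _ = (\mxblock_(a, b) B a b) _ X]tagnat.sig2K.
  have := mxblockK B (f (tagnat.sig1 s)) (tagnat.sig1 u).
  by move/matrixP/(_ (tagnat.sig2 s) (tagnat.sig2 u)); rewrite mxE => <-.
apply: sqdet_mxsub_sqr => //.
by rewrite [RHS](reindex_inj fi).
Qed.

End SquareDeterminant.

(** * Homogenized matrices over B *)

Section Graded.
Variables (k : fieldType) (B : stdGradedArtinian k).

Lemma gr_mul1 (y b : B) (j : int) :
  y \in gr B 1 -> b \in gr B j -> y * b \in gr B (j + 1).
Proof.
move=> /(@grnP _ B) [p hp <-]; case: j => [j|j]; last first.
  by rewrite memv0 => /eqP ->; rewrite mulr0 mem0v.
move=> /(@grnP _ B) [q hq <-]; have -> : j%:Z + 1 = (1 + j)%N by lia.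
rewrite -rmorphM; apply/(@grnP _ B); exists (p * q) => //.
exact: dhomogM.
Qed.

Lemma gr_mulX (y b : B) (j : int) (m : nat) :
  y \in gr B 1 -> b \in gr B j -> y ^+ m * b \in gr B (j + m%:Z).
Proof.
move=> y1 bj; elim: m => [|m IHm]; first by rewrite mul1r addr0.
by rewrite exprS -mulrA -addn1 PoszD addrA gr_mul1.
Qed.

Lemma gr_lt0 (j : int) : j < 0 -> gr B j = 0%VS.
Proof. by case: j. Qed.

Lemma gr_gt_socle (s : nat) (j : int) :
  is_socle_degree B s -> s%:Z < j -> gr B j = 0%VS.
Proof. by move=> [_ h]; case: j => // j sj; apply: h; rewrite -ltz_nat. Qed.

End Graded.

Section Operators.
Variables (k : fieldType) (B : stdGradedArtinian k) (y : B) (d : nat).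
Implicit Types (rho gam del : 'I_d -> int) (X Y : 'M[k]_d).

(** On a supported matrix the exponent [rho a - gam b] is nonnegative wherever the entry is nonzero,
    so the absolute value only serves to make the definition total. *)
Definition homog_mx rho gam X : 'M[B]_d :=
  \matrix_(a, b) (X a b *: y ^+ `|rho a - gam b|%N).

(** The exponents add up, because both are nonnegative in every term that does not vanish. *)
Lemma homog_mxM rho gam del X Y : supported rho gam X -> supported gam del Y ->
  homog_mx rho gam X *m homog_mx gam del Y = homog_mx rho del (X *m Y).
Proof.
move=> sX sY; apply/matrixP => a b; rewrite !mxE scaler_suml.
apply: eq_bigr => c _; rewrite !mxE -scalerAl -scalerAr scalerA.
have [->|Xac] := eqVneq (X a c) 0; first by rewrite !mul0r !scale0r.
have [->|Ycb] := eqVneq (Y c b) 0; first by rewrite !mulr0 !scale0r.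
rewrite -exprD; congr (_ *: _ ^+ _).
have := sX _ _ Xac; have := sY _ _ Ycb; lia.
Qed.

Lemma homog_mx1 rho : homog_mx rho rho 1%:M = 1%:M.
Proof.
apply/matrixP => a b; rewrite !mxE; case: (eqVneq a b) => [->|_].
  by rewrite subrr scale1r.
by rewrite scale0r.
Qed.

Hypothesis y1 : y \in gr B 1.

Definition gvec rho (v : 'cV[B]_d) : Prop := forall a, v a 0 \in gr B (rho a).

Lemma homog_mx_mem rho gam X a b c : supported rho gam X -> c \in gr B (gam b) ->
  homog_mx rho gam X a b * c \in gr B (rho a).
Proof.
move=> sX cg; rewrite mxE -scalerAl.
have [->|Xab] := eqVneq (X a b) 0; first by rewrite scale0r mem0v.
apply: memvZ; have := gr_mulX `|rho a - gam b|%N y1 cg.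
have -> // : gam b + `|rho a - gam b|%N = rho a.
by have := sX _ _ Xab; lia.
Qed.

Lemma homog_mx_gvec rho gam X v : supported rho gam X -> gvec gam v ->
  gvec rho (homog_mx rho gam X *m v).
Proof.
by move=> sX gv a; rewrite mxE; apply: memv_suml => b _; apply: homog_mx_mem.
Qed.

Definition graded_inj gam (N : 'M[B]_d) : Prop :=
  forall v, gvec gam v -> N *m v = 0 -> v = 0.

Definition graded_surj rho gam (N : 'M[B]_d) : Prop :=
  forall w, gvec rho w -> exists2 v, gvec gam v & N *m v = w.

Section Equivalence.
Variables (rho gam : 'I_d -> int) (L U X : 'M[k]_d).
Hypotheses (sX : supported rho gam X) (hLU : graded_LU rho gam L U).

Let N := homog_mx rho gam X.
Let N' := homog_mx rho gam (L *m X *m U).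
Let P := homog_mx rho rho L.
Let Q := homog_mx gam gam U.

Lemma homog_mx_LU : N' = P *m N *m Q.
Proof.
have [_ _ sL sU _ _] := hLU; rewrite /N /N' /P /Q homog_mxM // homog_mxM //.
exact: supportedM sL sX.
Qed.

(** The homogenized [L] and [U] are invertible, and they and their inverses preserve the degrees of
    graded vectors. *)
Lemma graded_inj_LU : graded_inj gam N <-> graded_inj gam N'.
Proof.
have [_ _ sL sU [L' LL' sL'] [U' UU' sU']] := hLU.
have PP' : homog_mx rho rho L' *m P = 1%:M.
  by rewrite /P homog_mxM ?(mulmx1C LL') ?homog_mx1.
have QQ' : Q *m homog_mx gam gam U' = 1%:M.
  by rewrite /Q homog_mxM ?(mulmx1C UU') ?homog_mx1.
have Q'Q : homog_mx gam gam U' *m Q = 1%:M.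
  by rewrite /Q homog_mxM ?UU' ?homog_mx1.
rewrite homog_mx_LU; split=> h v gv.
  rewrite -!mulmxA => /(congr1 (mulmx (homog_mx rho rho L'))).
  rewrite mulmx0 mulmxA PP' mul1mx => /h Qv0.
  by rewrite -[v]mul1mx -Q'Q -mulmxA Qv0 ?mulmx0 //; apply: homog_mx_gvec.
move=> Nv; rewrite -[v]mul1mx -QQ' -mulmxA (h (homog_mx gam gam U' *m v)) ?mulmx0 //.
  exact: homog_mx_gvec.
by rewrite mulmxA -(mulmxA (P *m N) Q) QQ' mulmx1 -mulmxA Nv mulmx0.
Qed.

Lemma graded_surj_LU : graded_surj rho gam N <-> graded_surj rho gam N'.
Proof.
have [_ _ sL sU [L' LL' sL'] [U' UU' sU']] := hLU.
have PP' : homog_mx rho rho L' *m P = 1%:M.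
  by rewrite /P homog_mxM ?(mulmx1C LL') ?homog_mx1.
have P'P : P *m homog_mx rho rho L' = 1%:M.
  by rewrite /P homog_mxM ?LL' ?homog_mx1.
have QQ' : Q *m homog_mx gam gam U' = 1%:M.
  by rewrite /Q homog_mxM ?(mulmx1C UU') ?homog_mx1.
rewrite homog_mx_LU; split=> h w gw.
  have [|v gv Nv] := h (homog_mx rho rho L' *m w); first exact: homog_mx_gvec.
  exists (homog_mx gam gam U' *m v); first exact: homog_mx_gvec.
  by rewrite mulmxA -(mulmxA (P *m N) Q) QQ' mulmx1 -mulmxA Nv mulmxA P'P mul1mx.
have [|v gv Nv] := h (P *m w); first exact: homog_mx_gvec.
exists (Q *m v); first exact: homog_mx_gvec.
have := congr1 (mulmx (homog_mx rho rho L')) Nv.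
by rewrite -!mulmxA !(mulmxA (homog_mx rho rho L') P) PP' !mul1mx.
Qed.

End Equivalence.

End Operators.

(** * Coordinate matrices of multiplications in B *)

Section Coordinates.
Variables (k : fieldType) (B : stdGradedArtinian k) (y : B) (d : nat).
Hypothesis y1 : y \in gr B 1.
Variable bas : forall j : int, (\dim (gr B j)).-tuple B.
Hypothesis basP : forall j, basis_of (gr B j) (bas j).

(** In contrast with [Mbar], source and target degrees are independent, which avoids casts between
    degrees that are only provably equal. *)
Definition coord_mx (j' j : int) (c : B) : 'M[k]_(\dim (gr B j'), \dim (gr B j)) :=
  \matrix_(u, v) coord (bas j') u (c * tnth (bas j) v).

Lemma tnth_bas j u : tnth (bas j) u \in gr B j.
Proof. by rewrite (basis_mem (basP j)) // mem_tnth. Qed.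

Lemma coord_mx1 j : coord_mx j j 1 = 1%:M.
Proof.
apply/matrixP => u v; rewrite !mxE mul1r (tnth_nth 0) coord_free.
  by rewrite eq_sym.
exact: basis_free (basP j).
Qed.

Lemma coord_mxZ j' j a c : coord_mx j' j (a *: c) = a *: coord_mx j' j c.
Proof. by apply/matrixP => u v; rewrite !mxE -scalerAl linearZ. Qed.

Lemma coord_mx_sum (I : finType) j' j (F : I -> B) :
  coord_mx j' j (\sum_i F i) = \sum_i coord_mx j' j (F i).
Proof.
apply/matrixP => u v; rewrite mxE summxE mulr_suml linear_sum /=.
by apply: eq_bigr => i _; rewrite mxE.
Qed.

Lemma coord_mxM j'' j' j c c' :
  (forall b, b \in gr B j -> c' * b \in gr B j') ->
  coord_mx j'' j' c *m coord_mx j' j c' = coord_mx j'' j (c * c').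
Proof.
move=> hc; apply/matrixP => u v; rewrite !mxE -mulrA.
rewrite [in RHS](coord_basis (basP j') (hc _ (tnth_bas v))) mulr_sumr linear_sum /=.
apply: eq_bigr => w _; rewrite !mxE -scalerAr linearZ /= mulrC.
by rewrite (tnth_nth 0 (bas j')).
Qed.

Definition blockcoord_mx (rho gam : 'I_d -> int) (N : 'M[B]_d) :=
  \mxblock_(a, b) coord_mx (rho a) (gam b) (N a b).

Lemma blockcoord_mxM (rho gam del : 'I_d -> int) N (X : 'M[k]_d) :
  supported gam del X ->
  blockcoord_mx rho gam N *m blockcoord_mx gam del (homog_mx y gam del X)
    = blockcoord_mx rho del (N *m homog_mx y gam del X).
Proof.
move=> sX; rewrite mul_mxblock; apply: eq_mxblock => a b.
rewrite [X in coord_mx _ _ X]mxE coord_mx_sum; apply: eq_bigr => c _.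
by rewrite coord_mxM // => e; apply: homog_mx_mem.
Qed.

Lemma det_blockcoord_mx_unitrig (rho : 'I_d -> int) (L : 'M[k]_d) : unitrig L ->
  \det (blockcoord_mx rho rho (homog_mx y rho rho L)) = 1.
Proof.
move=> [L0 L1]; apply: det_mxblock_unitrig => [a b ab|a].
  rewrite mxE L0 // scale0r; apply/matrixP => u v.
  by rewrite !mxE mul0r linear0.
by rewrite mxE L1 scale1r subrr expr0 coord_mx1.
Qed.

Lemma det_blockcoord_mx_unitrig_tr (gam : 'I_d -> int) (U : 'M[k]_d) : unitrig U^T ->
  \det (blockcoord_mx gam gam (homog_mx y gam gam U)) = 1.
Proof.
move=> [U0 U1]; rewrite -det_tr tr_mxblock; apply: det_mxblock_unitrig => [a b ab|a].
  have := U0 a b ab; rewrite !mxE => ->; rewrite scale0r; apply/matrixP => u v.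
  by rewrite !mxE mul0r linear0.
by have := U1 a; rewrite !mxE => ->; rewrite scale1r subrr expr0 coord_mx1 trmx1.
Qed.

End Coordinates.

(** * The binomial matrix *)

Section BinomialMatrix.
Variables (k : fieldType) (d t : nat).
Local Open Scope nat_scope.

(* The x-degree of row q of the reordered matrix is d - 1 - rowidx q.  For
   q < d - t it equals q + t, so that the diagonal entry is C(t, t) and carries
   y^0; for q >= d - t the diagonal entry carries y^(2q + t - (d - 1)). *)
Definition rowidx (q : nat) : nat := if q < d - t then d - 1 - t - q else q.

(** Initial segments of length at least d - t are stable under the reordering, so it changes the
    leading minors of these sizes by a sign only. *)
Lemma rowidx_lt (m q : nat) : d - t <= m -> q < m -> rowidx q < m.
Proof. by rewrite /rowidx; case: ifP; lia. Qed.

Lemma rowidx_inj (q q' : nat) : rowidx q = rowidx q' -> q = q'.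
Proof. by rewrite /rowidx; do 2!case: ifP; lia. Qed.

Lemma rowidx_row_proof (q : 'I_d) : d - 1 - rowidx q < d.
Proof. by have := ltn_ord q; lia. Qed.

Definition row_of (q : 'I_d) : 'I_d := Ordinal (rowidx_row_proof q).

Lemma row_of_inj : injective row_of.
Proof.
move=> q q' /(congr1 val) /= e; apply/val_inj/rowidx_inj.
rewrite /=; have := rowidx_lt (leq_subr t d) (ltn_ord q).
by have := rowidx_lt (leq_subr t d) (ltn_ord q'); lia.
Qed.

Definition binmx (m : nat) : 'M[k]_m :=
  \matrix_(a, b) (binz t (d%:Z - 1 - (rowidx a)%:Z - b%:Z)%R)%:R%R.

Lemma lead_binmx (m : nat) (md : m <= d) : lead md (binmx d) = binmx m.
Proof. by apply/matrixP => a b; rewrite !mxE. Qed.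

Lemma binz_eq0 (j : int) : (j < 0)%R || (t%:Z < j)%R -> binz t j = 0.
Proof. by case: j => // j /= tj; rewrite bin_small. Qed.

(** In a row [a] with a < d - t the binomial index at (a, b) is t + a - b: it equals t on the
    diagonal and exceeds t below it. *)
Lemma det_binmx_small (m : nat) : m <= d - t -> \det (binmx m) = 1%R.
Proof.
move=> md; rewrite -det_tr; apply: det_unitrig; split=> [a b ab|a]; rewrite !mxE.
  by rewrite binz_eq0 // /rowidx; have := ltn_ord b; case: ifP; lia.
have -> : (d%:Z - 1 - (rowidx a)%:Z - a%:Z = t%:Z)%R.
  by rewrite /rowidx; have := ltn_ord a; case: ifP; lia.
by rewrite /= binn.
Qed.

(** The two matrices differ by the permutation [rowidx] of the rows. *)
Lemma det_binmx_sqr (m : nat) : d - t <= m -> m <= d ->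
  (\det (binmx m) ^+ 2 = (\det (Cmx t (d - m) d))%:~R ^+ 2 :> k)%R.
Proof.
move=> tm md; have e : d - (d - m) = m by rewrite subKn.
pose f (a : 'I_m) : 'I_(d - (d - m)) :=
  cast_ord (esym e) (Ordinal (rowidx_lt tm (ltn_ord a))).
rewrite -det_map_mx -!sqdetE.
rewrite -(@sqdet_mxsub_sqr _ _ _ m m _ f (cast_ord (esym e))) //.
- congr ((sqdet _ ^+ 2)%R); apply/matrixP => a b; rewrite !mxE /=.
  by rewrite -pmulrn.
- by move=> a b /(congr1 val)/rowidx_inj/val_inj.
- exact: cast_ord_inj.
Qed.

(** With the rows reversed the binomial index at (a, b) is a - b, so the matrix becomes lower
    unitriangular. Hence p = 0 demands nothing of the characteristic. *)
Lemma det_Cmx0_sqr : (\det (Cmx t 0 d) ^+ 2 = 1)%R.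
Proof.
pose f (a : 'I_d) : 'I_(d - 0) := cast_ord (esym (subn0 d)) (rev_ord a).
rewrite -!sqdetE.
rewrite -(@sqdet_mxsub_sqr _ _ _ d d _ f (cast_ord (esym (subn0 d)))) //.
- rewrite sqdetE det_unitrig ?expr1n //; split=> [a b ab|a]; rewrite !mxE /=.
    by rewrite binz_eq0 //; have := ltn_ord b; lia.
  have -> : (d%:Z - 1 - (d - a.+1)%:Z - a%:Z = 0)%R by have := ltn_ord a; lia.
  by rewrite /= bin0.
- by move=> a b /cast_ord_inj/rev_ord_inj.
- exact: cast_ord_inj.
- by rewrite subn0.
- by rewrite subn0.
Qed.

Variable i : nat.

(** The coefficient of x^r in an element of degree j of A has degree j - r in B; r is [row_of q] in
    the target and [q] in the source. *)
Definition rowdeg (q : 'I_d) : int := (i%:Z + t%:Z - (row_of q)%:Z)%R.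
Definition coldeg (q : 'I_d) : int := (i%:Z - q%:Z)%R.

Lemma rowdegE (q : 'I_d) : (rowdeg q = i%:Z + t%:Z - (d%:Z - 1) + (rowidx q)%:Z)%R.
Proof.
rewrite /rowdeg /=; rewrite /=; have := rowidx_lt (leq_subr t d) (ltn_ord q).
by have := ltn_ord q; lia.
Qed.

Lemma rowdeg_lo (q : 'I_d) : q < d - t -> rowdeg q = coldeg q.
Proof. by move=> h; rewrite rowdegE /coldeg /rowidx h; lia. Qed.

Lemma rowdeg_hi (q : 'I_d) : d - t <= q ->
  (rowdeg q = i%:Z + q%:Z + t%:Z - (d%:Z - 1))%R.
Proof. by move=> h; rewrite rowdegE /rowidx ltnNge h /=; lia. Qed.

Lemma rowdeg_exp (q : 'I_d) : d - t <= q ->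
  (rowdeg q = coldeg q + (2 * q + t - (d - 1))%N%:Z)%R.
Proof. by move=> h; rewrite rowdeg_hi // /coldeg; have := ltn_ord q; lia. Qed.

Lemma rowdeg_mono (a b : 'I_d) : d - t <= a -> a <= b -> (rowdeg a <= rowdeg b)%R.
Proof. by move=> ha ab; rewrite !rowdeg_hi ?(leq_trans ha) //; lia. Qed.

Lemma coldeg_anti (a b : 'I_d) : a < b -> (coldeg b <= coldeg a)%R.
Proof. by rewrite /coldeg; lia. Qed.

(** If j is the binomial index at (a, b), then [rowdeg a - coldeg b] is t - j, and C(t, j) = 0 for j
    > t. *)
Lemma supported_binmx : supported rowdeg coldeg (binmx d).
Proof.
move=> a b; rewrite mxE; apply: contraR; rewrite -ltNge rowdegE /coldeg => h.
by rewrite binz_eq0 //; lia.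
Qed.

Lemma binmx_elimination (n : nat) : n <= d ->
  (forall m, m <= n -> (\det (binmx m) != 0)%R) ->
  exists L U, graded_LU rowdeg coldeg L U /\ eliminated n (L *m binmx d *m U)%R.
Proof.
move=> nd h; apply: graded_elimination => //.
- exact: coldeg_anti.
(* The row degrees decrease before d - t, but there they agree with the column degrees; from d - t
   on they increase. *)
- move=> a b bn ba; have [b1|b1] := ltnP b (d - t).
    by left; rewrite rowdeg_lo.
  by right; apply: rowdeg_mono => //; apply: ltnW.
- exact: supported_binmx.
- by move=> m md mn; rewrite lead_binmx h.
Qed.

End BinomialMatrix.

(** * The algebra B[x]/(x^d) *)

Section TensorPowers.
Variables (k : fieldType) (B : stdGradedArtinian k) (d : nat).
Hypothesis d_gt0 : (0 < d)%N.
Variable y : B.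

Let l : tens B d := tinc d y + tvar B d.

Lemma xcoef_in_qpoly (p : {poly B}) (r : nat) : (r < d)%N ->
  xcoef (in_qpoly 'X^d p : tens B d) r = p`_r.
Proof.
move=> rd; rewrite /xcoef /= mk_monic_Xn prednK //.
by rewrite -Pdiv.RingMonic.take_poly_rmodp coef_take_poly rd.
Qed.

Lemma xcoef_ext (a b : tens B d) :
  (forall r, (r < d)%N -> xcoef a r = xcoef b r) -> a = b.
Proof.
move=> h; apply: val_inj; apply/polyP => r; have [|dr] := ltnP r d; first exact: h.
have sz (c : tens B d) : (size (val c) <= d)%N.
  by apply: leq_trans (size_npoly c) _; rewrite mk_monic_Xn size_polyXn prednK.
by rewrite !nth_default // (leq_trans (sz _) dr).
Qed.

Lemma xcoefD (a b : tens B d) r : xcoef (a + b) r = xcoef a r + xcoef b r.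
Proof. by rewrite /xcoef /= coefD. Qed.

Lemma xcoef_tinc (b : B) r : xcoef (tinc d b) r = if r == 0%N then b else 0.
Proof. by rewrite /xcoef /tinc qpolyCE coefC. Qed.

Lemma xcoef_tvar r : (r < d)%N -> xcoef (tvar B d) r = (r == 1%N)%:R.
Proof. by move=> rd; rewrite xcoef_in_qpoly // coefX. Qed.

Lemma xcoef_powl (t u : nat) : (u < d)%N ->
  xcoef (l ^+ t) u = y ^+ (t - u) *+ 'C(t, u).
Proof.
elim: t u => [|t IHt] u ud.
  by rewrite expr0 -[1]/(tinc d 1) xcoef_tinc bin0n; case: u {ud}.
rewrite exprS xcoefM // /l.
have lE v : (v <= u)%N -> xcoef l v = (if v == 0%N then y else 0) + (v == 1%N)%:R.
  by move=> vu; rewrite xcoefD xcoef_tinc xcoef_tvar // (leq_ltn_trans vu).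
case: u ud lE => [|u] ud lE.
  rewrite big_ord_recl big_ord0 addr0 lE // IHt //= addr0 !bin0 !subn0.
  by rewrite exprS.
rewrite 2!big_ord_recl big1 ?addr0 => [|v _].
  rewrite !lE // !IHt ?(ltnW ud) //=; last by rewrite (leq_ltn_trans _ ud) // leq_subr.
  rewrite addr0 add0r mul1r subn0 /bump /= add1n subSS subn0.
  rewrite binS mulrnDr; congr (_ + _); have [ut|tu] := ltnP u t.
    by rewrite mulrnAr -exprS subnSK.
  by rewrite bin_small // !mulr0n mulr0.
by rewrite lE ?ltn_ord //= addr0 mul0r.
Qed.

(** The binomial coefficient vanishes both for u > r and where t - r + u is negative. The sum can
    thus run over all u < d, which gives it the form of a matrix product. *)
Lemma xcoef_powlM (t r : nat) (a : tens B d) : (r < d)%N ->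
  xcoef (l ^+ t * a) r =
    \sum_(u < d) (binz t (r%:Z - u%:Z))%:R *:
      (y ^+ absz (t%:Z - r%:Z + u%:Z) * xcoef a u).
Proof.
move=> rd; rewrite xcoefM // [RHS](bigID (fun u : 'I_d => (u < r.+1)%N)) /=.
rewrite [X in _ = _ + X]big1 ?addr0; last first.
  move=> u; rewrite -leqNgt => ru; rewrite binz_eq0 ?scale0r //; lia.
rewrite (big_ord_narrow rd) (reindex_inj rev_ord_inj) /=.
apply: eq_bigr => u _; rewrite subSS xcoef_powl; last by lia.
have e : (r - (r - u) = u)%N by have := ltn_ord u; lia.
have -> : r%:Z - u%:Z = (r - u)%N by have := ltn_ord u; lia.
rewrite e /= scaler_nat mulrnAl.
have [le|lt] := leqP (r - u) t.
  congr (_ ^+ _ * _ *+ _); have := ltn_ord u; lia.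
by rewrite bin_small.
Qed.

Lemma xcoef_Xinc (r u : nat) (b : B) : (r < d)%N -> (u < d)%N ->
  xcoef (tvar B d ^+ r * tinc d b) u = if u == r then b else 0.
Proof.
move=> rd ud; have -> : tvar B d ^+ r * tinc d b = in_qpoly 'X^d ('X^r * b%:P).
  have -> : tinc d b = in_qpoly 'X^d b%:P.
    apply: xcoef_ext => v vd; rewrite xcoef_in_qpoly // xcoef_tinc coefC.
  by rewrite in_qpolyM; congr (_ * _); rewrite rmorphXn.
by rewrite xcoef_in_qpoly // coefMC coefXn; case: eqP; rewrite ?mul1r ?mul0r.
Qed.

End TensorPowers.

(** * Rank of an eliminated matrix *)

Section DiagonalRank.
Variables (k : fieldType) (B : stdGradedArtinian k) (y : B) (d : nat).
Hypothesis y1 : y \in gr B 1.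
Variables rho gam : 'I_d -> int.
Implicit Types (a b q : 'I_d).

Definition diag_inj : Prop :=
  forall q v, v \in gr B (gam q) -> y ^+ `|rho q - gam q|%N * v = 0 -> v = 0.

Definition diag_surj : Prop :=
  forall q w, w \in gr B (rho q) ->
    exists2 v, v \in gr B (gam q) & y ^+ `|rho q - gam q|%N * v = w.

(** This makes the block that elimination leaves untouched harmless: it has zero source or zero
    target. *)
Definition vanish_from (n : nat) : Prop :=
  (forall q, (n <= q)%N -> gr B (gam q) = 0%VS) \/
  (forall q, (n <= q)%N -> gr B (rho q) = 0%VS).

Variables (X : 'M[k]_d) (n : nat).
Hypothesis sX : supported rho gam X.
Hypothesis eX : eliminated n X.
Hypothesis pX : forall q, (q < n)%N -> X q q != 0.
Hypothesis gam_rho : forall q, gam q <= rho q.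
Let D := homog_mx y rho gam X.

Lemma gr0_eq0 (j : int) (v : B) : gr B j = 0%VS -> v \in gr B j -> v = 0.
Proof. by move=> ->; rewrite memv0 => /eqP. Qed.

Lemma pow_mem (j j' : int) (v : B) : j <= j' -> v \in gr B j ->
  y ^+ `|j' - j|%N * v \in gr B j'.
Proof.
move=> jj' vj; have := gr_mulX `|j' - j|%N y1 vj.
by rewrite gez0_abs ?subr_ge0 // subrKC.
Qed.

Definition unitv q (v : B) : 'cV[B]_d := \col_a (if a == q then v else 0).

Lemma unitv_gvec (del : 'I_d -> int) q v :
  v \in gr B (del q) -> gvec del (unitv q v).
Proof. by move=> vq a; rewrite mxE; case: eqP => [->//|_]; rewrite mem0v. Qed.

Lemma unitv_eq0 q v : unitv q v = 0 -> v = 0.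
Proof. by move/colP/(_ q); rewrite !mxE eqxx. Qed.

Lemma homog_mx_unitv q v a : (D *m unitv q v) a 0 = D a q * v.
Proof.
rewrite mxE (bigD1 q) //= big1 ?addr0; first by rewrite [unitv q v q 0]mxE eqxx.
by move=> b bq; rewrite [unitv q v b 0]mxE (negPf bq) mulr0.
Qed.

Lemma homog_mx_eliminated a b : (a < n)%N || (b < n)%N -> a != b -> D a b = 0.
Proof. by move=> ab nab; rewrite mxE eX // scale0r. Qed.

Lemma mul_pivot (v : 'cV[B]_d) a : (a < n)%N ->
  (D *m v) a 0 = y ^+ `|rho a - gam a|%N * (X a a *: v a 0).
Proof.
move=> an; rewrite mxE (bigD1 a) //= big1 ?addr0.
  by rewrite mxE -scalerAl -scalerAr.
by move=> b ba; rewrite homog_mx_eliminated ?an ?mul0r // eq_sym.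
Qed.

Lemma mul_tail (v : 'cV[B]_d) a : (n <= a)%N ->
  (D *m v) a 0 = \sum_(b < d | (n <= b)%N) D a b * v b 0.
Proof.
move=> na; rewrite mxE (bigID (fun b : 'I_d => (n <= b)%N)) /=.
rewrite [X in _ + X]big1 ?addr0 // => b; rewrite -ltnNge => bn.
rewrite homog_mx_eliminated ?bn ?orbT ?mul0r //.
by apply: contraTneq na => ->; rewrite -ltnNge.
Qed.

Lemma homog_mx_killed q (v : B) : y ^+ `|rho q - gam q|%N * v = 0 -> D q q * v = 0.
Proof. by move=> h; rewrite mxE -scalerAl h scaler0. Qed.

Lemma pivot_inj q v : graded_inj gam D -> (q < n)%N -> v \in gr B (gam q) ->
  y ^+ `|rho q - gam q|%N * v = 0 -> v = 0.
Proof.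
move=> Dinj qn vq yv; apply: (@unitv_eq0 q); apply: Dinj; first exact: unitv_gvec.
apply/colP => a; rewrite homog_mx_unitv [RHS]mxE.
have [->|aq] := eqVneq a q; first by rewrite homog_mx_killed.
by rewrite homog_mx_eliminated ?mul0r // qn orbT.
Qed.

Lemma pivot_surj q w : graded_surj rho gam D -> (q < n)%N -> w \in gr B (rho q) ->
  exists2 v, v \in gr B (gam q) & y ^+ `|rho q - gam q|%N * v = w.
Proof.
move=> Dsurj qn wq; have [v gv Dv] := Dsurj _ (unitv_gvec wq).
exists (X q q *: v q 0); first exact: memvZ.
by rewrite -mul_pivot // Dv mxE eqxx.
Qed.

(** The first [n] coordinates decouple and their pivots are units. In the tail, zero sources leave
    nothing to prove, while zero targets put every source in the kernel, on both sides of the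
    equivalence. *)
Lemma graded_inj_diag : vanish_from n -> graded_inj gam D <-> diag_inj.
Proof.
move=> dn; split=> [Dinj q v vq yv|h v gv Dv].
  have [qn|nq] := ltnP q n; first exact: pivot_inj yv.
  case: dn => dn; first exact: gr0_eq0 (dn q nq) vq.
  apply: (@unitv_eq0 q); apply: Dinj; first exact: unitv_gvec.
  apply/colP => a; rewrite homog_mx_unitv [RHS]mxE.
  have [an|na] := ltnP a n.
    rewrite homog_mx_eliminated ?an ?mul0r //.
    by apply: contraTneq an => ->; rewrite -leqNgt.
  by apply: gr0_eq0 (dn a na) _; apply: homog_mx_mem.
apply/colP => q; rewrite [RHS]mxE; have [qn|nq] := ltnP q n.
  have : X q q *: v q 0 = 0.
    by apply: h; [exact: memvZ | rewrite -mul_pivot // Dv mxE].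
  by move/eqP; rewrite scaler_eq0 (negPf (pX qn)) => /eqP.
apply: h => //; case: dn => dn.
  by rewrite (gr0_eq0 (dn q nq) (gv q)) mulr0.
apply: gr0_eq0 (dn q nq) _.
exact: pow_mem.
Qed.

(** Dual to the injective case: when the tail sources vanish, surjectivity on either side forces the
    tail targets to vanish. *)
Lemma graded_surj_diag : vanish_from n -> graded_surj rho gam D <-> diag_surj.
Proof.
move=> dn; split=> [Dsurj q w wq|h w gw].
  have [qn|nq] := ltnP q n; first exact: pivot_surj.
  suff -> : w = 0 by exists 0; rewrite ?mem0v ?mulr0.
  case: dn => dn; last exact: gr0_eq0 (dn q nq) wq.
  have [v gv Dv] := Dsurj _ (unitv_gvec wq).
  have /colP/(_ q) := Dv; rewrite [RHS]mxE eqxx => <-.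
  by rewrite mul_tail // big1 // => b nb; rewrite (gr0_eq0 (dn b nb) (gv b)) mulr0.
have [f fP1 fP2] := fin_all_exists2 (fun q => h q _ (gw q)).
exists (\col_q (if (q < n)%N then (X q q)^-1 *: f q else 0)).
  by move=> q; rewrite mxE; case: ifP; rewrite ?mem0v // => _; apply: memvZ.
apply/colP => a; have [an|na] := ltnP a n.
  by rewrite mul_pivot // mxE an scalerA mulfV ?scale1r // pX.
rewrite mul_tail // big1 => [|b nb]; last by rewrite [X in _ * X]mxE ltnNge nb mulr0.
case: dn => dn; last by rewrite (gr0_eq0 (dn a na) (gw a)).
by rewrite -fP2 (gr0_eq0 (dn a na) (fP1 a)) mulr0.
Qed.

(* The pivot in position [n] may vanish (this is where [boundary_ok] fails):
   one implication survives. *)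
Section VanishingPivot.
Variable c : 'I_d.
Hypotheses (cn : c = n :> nat) (Xc : X c c = 0).
Hypothesis rho_mono : forall a, (c <= a)%N -> rho c <= rho a.
Hypothesis gam_anti : forall a, (c <= a)%N -> gam a <= gam c.

(** If the targets after [c] vanish, only row [c] could contribute, and its entry factors through
    the degree [gam c], where every element is 0. *)
Lemma vanish_tail_col q v : vanish_from n.+1 -> (n < q)%N -> v \in gr B (gam q) ->
  (forall u, u \in gr B (gam c) -> u = 0) -> D *m unitv q v = 0.
Proof.
move=> dn nq vq u0; apply/colP => a; rewrite homog_mx_unitv [RHS]mxE.
case: dn => dn; first by rewrite (gr0_eq0 (dn q nq) vq) mulr0.
have [na|an|an] := ltngtP n a.
- by apply: gr0_eq0 (dn a na) _; apply: homog_mx_mem.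
- rewrite homog_mx_eliminated ?an ?mul0r //.
  by apply: contraTneq an => ->; rewrite -leqNgt ltnW.
have {an} -> : a = c by apply: val_inj; rewrite /= -an cn.
have cq : (c <= q)%N by rewrite cn ltnW.
rewrite mxE; have [->|Xcq] := eqVneq (X c q) 0; first by rewrite scale0r mul0r.
have -> : `|rho c - gam q|%N = (`|rho c - gam c| + `|gam c - gam q|)%N.
  by have := gam_rho c; have := gam_anti cq; lia.
rewrite exprD -scalerAl -mulrA (u0 (y ^+ _ * v)) ?mulr0 ?scaler0 //.
exact: pow_mem (gam_anti cq) vq.
Qed.

Lemma graded_inj_diag_boundary : vanish_from n.+1 -> graded_inj gam D -> diag_inj.
Proof.
move=> dn Dinj q v vq yv; have [qn|nq|qn] := ltngtP q n.
- exact: pivot_inj yv.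
- have [dg|dr] := dn; first exact: gr0_eq0 (dg q nq) vq.
  apply: (@unitv_eq0 q); apply: (Dinj); first exact: unitv_gvec.
  apply: vanish_tail_col => // u uc.
  (* Column [c] acts as zero: its pivot is 0 and the targets below are trivial. Injectivity
     therefore kills the source of [c]. *)
  apply: (@unitv_eq0 c); apply: Dinj; first exact: unitv_gvec.
  apply/colP => a; rewrite homog_mx_unitv [RHS]mxE.
  have [na|an|an] := ltngtP n a.
  + by apply: gr0_eq0 (dr a na) _; apply: homog_mx_mem.
  + rewrite homog_mx_eliminated ?an ?mul0r //.
    by apply: contraTneq an => ->; rewrite -leqNgt cn.
  have -> : a = c by apply: val_inj; rewrite /= -an cn.
  by rewrite mxE Xc scale0r mul0r.
have {qn} qc : q = c by apply: val_inj; rewrite /= qn cn.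
rewrite {}qc in vq yv *; apply: (@unitv_eq0 c); apply: Dinj; first exact: unitv_gvec.
apply/colP => a; rewrite homog_mx_unitv [RHS]mxE.
have [ca|ac|ac] := ltngtP c a.
(* Below the diagonal, column [c] multiplies by a power of [y] that factors through the exponent
   [rho c - gam c], which already kills [v]. *)
- rewrite mxE -scalerAl; have [->|Xac] := eqVneq (X a c) 0; first by rewrite scale0r.
  have -> : `|rho a - gam c|%N = (`|rho a - rho c| + `|rho c - gam c|)%N.
    by have := gam_rho c; have := rho_mono (ltnW ca); lia.
  by rewrite exprD -mulrA yv mulr0 scaler0.
- rewrite homog_mx_eliminated -?cn ?ac ?mul0r //.
  by apply: contraTneq ac => ->; rewrite ltnn.
- have -> : a = c by apply: val_inj.
  by rewrite mxE Xc scale0r mul0r.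
Qed.

Lemma graded_surj_diag_boundary :
  vanish_from n.+1 -> graded_surj rho gam D -> diag_surj.
Proof.
move=> dn Dsurj q w wq; have [qn|nq] := ltnP q n; first exact: pivot_surj.
have cq : (c <= q)%N by rewrite cn.
have [dg|dr] := dn.
  (* Only column [c] survives in the tail. Its zero pivot makes the target of [c] trivial, and the
     entries further down factor through that target. *)
  have tail (v : 'cV[B]_d) b : gvec gam v -> (n <= b)%N -> b != c -> v b 0 = 0.
    move=> gv nb bc; apply: gr0_eq0 (dg b _) (gv b).
    by rewrite ltn_neqAle nb -cn eq_sym val_eqE bc.
  have Dtail (v : 'cV[B]_d) a : gvec gam v -> (n <= a)%N ->
      (D *m v) a 0 = D a c * v c 0.
    move=> gv na; rewrite mul_tail // (bigD1 c) ?cn //= big1 ?addr0 //.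
    by move=> b /andP[nb bc]; rewrite tail ?mulr0.
  have wc0 u : u \in gr B (rho c) -> u = 0.
    move=> uc; have [v gv /colP/(_ c)] := Dsurj _ (unitv_gvec uc).
    by rewrite Dtail ?cn // !mxE eqxx Xc scale0r mul0r.
  suff -> : w = 0 by exists 0; rewrite ?mem0v ?mulr0.
  have [v gv /colP/(_ q)] := Dsurj _ (unitv_gvec wq).
  rewrite Dtail // [RHS]mxE eqxx => <-; rewrite mxE.
  have -> : `|rho q - gam c|%N = (`|rho q - rho c| + `|rho c - gam c|)%N.
    by have := gam_rho c; have := rho_mono cq; lia.
  by rewrite exprD -scalerAl -mulrA (wc0 (y ^+ _ * v c 0)) ?mulr0 ?scaler0 // pow_mem.
have [nq1|] := ltnP n q.
  exists 0; first exact: mem0v.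
  by rewrite (gr0_eq0 (dr q nq1) wq) mulr0.
rewrite -cn => qc; have {nq cq qc} qc : q = c.
  by apply: val_inj; apply/eqP; rewrite eqn_leq qc cq.
rewrite {}qc in wq *; have [v gv /colP/(_ c)] := Dsurj _ (unitv_gvec wq).
rewrite mul_tail ?cn // [RHS]mxE eqxx => <-.
(* Row [c] of the equation [D *m v = unitv c w], with the power of exponent [rho c - gam c] factored
   out of every term. *)
exists (\sum_(b < d | (n <= b)%N) X c b *: (y ^+ `|gam c - gam b|%N * v b 0)).
  apply: memv_suml => b nb; apply: memvZ; apply: pow_mem => //.
  by apply: gam_anti; rewrite cn.
rewrite mulr_sumr; apply: eq_bigr => b nb; rewrite mxE -scalerAr -scalerAl mulrA -exprD.
congr (_ *: (_ ^+ _ * _)); have := gam_rho c; have := @gam_anti b; rewrite cn nb.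
by move=> /(_ isT); lia.
Qed.

End VanishingPivot.

End DiagonalRank.

(** In characteristic zero this is [det_Cmx_neq0], where [n <= t.+1] provides p <= t; in prime
    characteristic a product nonzero in [k] has nonzero factors. *)
Lemma det_Cmx_pchar (k : fieldType) (t d m n : nat) : (n <= t.+1)%N ->
  [pchar k] =i pred0 \/
     (exists2 c : nat, c \in [pchar k] &
       ~~ (c%:Z %| \prod_(m <= p < n) \det (Cmx t p d))%Z) ->
  forall p, (m <= p < n)%N -> (\det (Cmx t p d))%:~R != 0 :> k.
Proof.
move=> nt hchar p hp; case: hchar => [/pcharf0P k0|[c kc]].
  have pt : (p <= t)%N by rewrite -ltnS (leq_trans _ nt) //; case/andP: hp.
  have := det_Cmx_neq0 d pt; case: (\det _) => j.
    by have := k0 j; rewrite pmulrn => ->.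
  by rewrite NegzE mulrNz !oppr_eq0; have := k0 j.+1; rewrite pmulrn => ->.
rewrite (dvdz_pcharf kc) rmorph_prod prodf_seq_eq0; apply: contraNneq => h.
by apply/hasP; exists p; rewrite ?mem_index_iota //= h.
Qed.

(** * Multiplication in A as a homogenized matrix over B *)

Section Transfer.
Variables (k : fieldType) (B : stdGradedArtinian k) (d t i : nat).
Hypothesis d_gt0 : (0 < d)%N.
Variable y : B.

Let l : tens B d := tinc d y + tvar B d.
Let rho := @rowdeg d t i.
Let gam := @coldeg d i.
Let N := homog_mx y rho gam (binmx k d t d).

Definition coefs (a : tens B d) : 'cV[B]_d := \col_q xcoef a q.

Lemma homog_mx_coefs (a : tens B d) (q : 'I_d) :
  (N *m coefs a) q 0 = xcoef (l ^+ t * a) (row_of t q).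
Proof.
rewrite mxE xcoef_powlM //; apply: eq_bigr => b _; rewrite !mxE -scalerAl.
have e : d%:Z - 1 - (rowidx d t q)%:Z = (row_of t q)%:Z.
  by rewrite /=; have := rowidx_lt (leq_subr t d) (ltn_ord q); lia.
rewrite e; congr (_ *: (_ ^+ _ * _)).
rewrite /rho /gam /rowdeg /coldeg; lia.
Qed.

Lemma tgrP (j : int) (a : tens B d) :
  reflect (forall r : 'I_d, xcoef a r \in gr B (j - r%:Z)) (a \in @tgr k B d j).
Proof. exact: forallP. Qed.

Lemma tens_of_coefs (v : 'I_d -> B) :
  exists a : tens B d, forall r : 'I_d, xcoef a r = v r.
Proof.
exists (in_qpoly 'X^d (\poly_(r < d) if insub r is Some r' then v r' else 0)).
by move=> r; rewrite xcoef_in_qpoly // coef_poly ltn_ord valK.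
Qed.

Lemma xcoefB (a b : tens B d) r : xcoef (a - b) r = xcoef a r - xcoef b r.
Proof. by rewrite /xcoef /= coefB. Qed.

Lemma row_of_onto (r : nat) : (r < d)%N -> exists q : 'I_d, r = row_of t q.
Proof.
move=> rd; have [g _ gK] := injF_bij (@row_of_inj d t).
by exists (g (Ordinal rd)); rewrite gK.
Qed.

Lemma tens_inj :
  inj_on (@tgr k B d i%:Z) (fun a : tens B d => l ^+ t * a) <-> graded_inj gam N.
Proof.
split=> [h v gv Nv|h a b /tgrP ga /tgrP gb e].
  have [a av] := tens_of_coefs (fun r => v r 0).
  have va : v = coefs a by apply/colP => r; rewrite mxE av.
  have a0 : a = 0.
    apply: h; first by apply/tgrP => r; rewrite av; apply: gv.
      by apply/tgrP => r; rewrite [xcoef _ _]coef0 mem0v.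
    rewrite mulr0; apply: xcoef_ext => // r /row_of_onto [q ->].
    by rewrite -homog_mx_coefs -va Nv mxE [RHS]coef0.
  by apply/colP => r; rewrite -av a0 [RHS]mxE [LHS]coef0.
have ab0 : coefs (a - b) = 0.
  apply: h => [r|]; first by rewrite mxE xcoefB memvB.
  apply/colP => q; rewrite homog_mx_coefs mulrBr e subrr mxE.
  exact: coef0.
apply: xcoef_ext => // r rd; apply/eqP; rewrite -subr_eq0 -xcoefB.
by have /colP/(_ (Ordinal rd)) := ab0; rewrite !mxE /= => ->.
Qed.

Lemma tens_surj : surj_on (@tgr k B d i%:Z) (@tgr k B d (i%:Z + t%:Z))
  (fun a : tens B d => l ^+ t * a) <-> graded_surj rho gam N.
Proof.
split=> [h w gw|h a /tgrP ga].
  have [g gK Kg] := injF_bij (@row_of_inj d t).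
  have [a av] := tens_of_coefs (fun r => w (g r) 0).
  have [|b /tgrP gb ba] := h a.
    apply/tgrP => r; rewrite av; have := gw (g r).
    by rewrite /rho /rowdeg Kg.
  exists (coefs b); first by move=> r; rewrite mxE; apply: gb.
  by apply/colP => q; rewrite homog_mx_coefs ba av gK.
have [|v gv Nv] := h (\col_q xcoef a (row_of t q)).
  by move=> q; rewrite mxE; apply: ga.
have [b bv] := tens_of_coefs (fun r => v r 0).
have vb : v = coefs b by apply/colP => r; rewrite mxE bv.
exists b; first by apply/tgrP => r; rewrite bv; apply: gv.
apply: xcoef_ext => // r /row_of_onto [q ->].
by rewrite -homog_mx_coefs -vb Nv mxE.
Qed.

End Transfer.

(** * Equivalence of the rank conditions *)

Section FullRank.
Variables (k : fieldType) (B : stdGradedArtinian k) (s d i t : nat).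
Let rho := @rowdeg d t i.
Let gam := @coldeg d i.
Let C := binmx k d t d.
(** One more than the bound min(d - 1, d - 1 - i - t + s, i) on q, or 0 when that is negative. *)
Let qmax1 := minn d (minn (d + s - (i + t)) (i + 1)).

Lemma coldeg_le_rowdeg (q : 'I_d) : gam q <= rho q.
Proof.
have [qd|dq] := ltnP q (d - t); first by rewrite /rho rowdeg_lo.
by rewrite /rho rowdeg_exp // lerDl.
Qed.

(** Leading minors survive the multiplication by [L] and [U], and those of an eliminated matrix are
    products of diagonal entries up to size n + 1; hence q = n is allowed. *)
Lemma pivot_minor (n : nat) (L U : 'M[k]_d) (q : 'I_d) :
  graded_LU rho gam L U -> eliminated n (L *m C *m U) -> (q <= n)%N ->
  \det (binmx k d t q.+1) = \det (binmx k d t q) * (L *m C *m U) q q.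
Proof.
move=> hLU eX qn.
have eq : eliminated q (L *m C *m U).
  move=> a b ab; apply: eX.
  by case/orP: ab => h; rewrite (leq_trans h qn) ?orbT.
have E m (md : (m <= d)%N) : \det (lead md (L *m C *m U)) = \det (binmx k d t m).
  by rewrite (det_lead_LU md C (LU_L hLU) (LU_U hLU)) lead_binmx.
rewrite -(E _ (ltn_ord q)) det_lead_eliminated // E.
by congr (_ * (_ *m _) _ _); apply: val_inj.
Qed.

Lemma pivots_neq0 (n : nat) (L U : 'M[k]_d) :
  graded_LU rho gam L U -> eliminated n (L *m C *m U) ->
  (forall m, (m <= n)%N -> \det (binmx k d t m) != 0) ->
  forall q : 'I_d, (q < n)%N -> (L *m C *m U) q q != 0.
Proof.
move=> hLU eX h q qn; have := h _ qn.
by rewrite (pivot_minor hLU eX (ltnW qn)) mulf_eq0 => /norP[].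
Qed.

Hypothesis hs : is_socle_degree B s.

(** From q = i + 1 on the source degree is negative; from q = d + s - (i + t) on, if also q >= d -
    t, the target degree exceeds the socle degree. *)
Lemma vanish_beyond : vanish_from B rho gam (maxn (d - t) qmax1).
Proof.
have [e|e] := leqP (i + 1) (d + s - (i + t)).
  left=> q hq; apply: gr_lt0; rewrite /gam /coldeg.
  by have := ltn_ord q; move: hq e; rewrite /qmax1; lia.
right=> q hq; apply: (gr_gt_socle hs); rewrite /rho rowdeg_hi; last by lia.
by have := ltn_ord q; move: hq e; rewrite /qmax1; lia.
Qed.

Hypothesis hC : forall p,
  (maxn 1 (maxn (d - i) (i + t + 1 - s)) <= p < minn d t)%N ->
  (\det (Cmx t p d))%:~R != 0 :> k.

(** A minor of size m > d - t is, up to sign, the determinant for p = d - m, and m < [qmax1] puts p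
    in the range of the hypothesis. Size [qmax1] itself falls one step below that range. *)
Lemma minor_neq0 (m : nat) : (m <= maxn (d - t) qmax1.-1)%N ->
  \det (binmx k d t m) != 0.
Proof.
move=> hm; have [mt|tm] := leqP m (d - t).
  by rewrite det_binmx_small ?oner_eq0.
have md : (m <= d)%N by move: hm; rewrite /qmax1; lia.
rewrite -sqrf_eq0 det_binmx_sqr ?(ltnW tm) // sqrf_eq0; apply: hC.
by move: hm; rewrite /qmax1; lia.
Qed.

Lemma minor_neq0_boundary (m : nat) : boundary_ok k s d i t ->
  (m <= maxn (d - t) qmax1)%N -> \det (binmx k d t m) != 0.
Proof.
move=> hb hm; have [mn|nm] := leqP m (maxn (d - t) qmax1.-1).
  exact: minor_neq0.
have md : (m <= d)%N by move: hm; rewrite /qmax1; lia.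
rewrite -sqrf_eq0 det_binmx_sqr ?sqrf_eq0 //; last by lia.
have -> : (d - m = maxn (d - (i + 1)) (i + t - s))%N.
  by move: hm nm; rewrite /qmax1; lia.
(* For p = 0 [boundary_ok] gives nothing, but the determinant is 1 or -1. *)
have [p0|p0] := posnP (maxn (d - (i + 1)) (i + t - s)).
  by rewrite p0 -sqrf_eq0 -rmorphXn /= det_Cmx0_sqr oner_eq0.
by apply: hb; rewrite p0 /=; move: hm nm; rewrite /qmax1; lia.
Qed.

Let sC : supported rho gam C := @supported_binmx k d t i.

Lemma supported_LU L U : graded_LU rho gam L U -> supported rho gam (L *m C *m U).
Proof.
by move=> hLU; apply: supportedM (supportedM (LU_sL hLU) sC) (LU_sU hLU).
Qed.

Variable y : B.
Hypothesis y1 : y \in gr B 1.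
Let N := homog_mx y rho gam C.

Lemma rank_iff_diag :
  (forall m, (m <= maxn (d - t) qmax1)%N -> \det (binmx k d t m) != 0) ->
  (graded_inj gam N <-> diag_inj y rho gam) /\
  (graded_surj rho gam N <-> diag_surj y rho gam).
Proof.
move=> h; have nd : (maxn (d - t) qmax1 <= d)%N by rewrite /qmax1; lia.
have [L [U [hLU eX]]] := binmx_elimination i nd h.
have pX := pivots_neq0 hLU eX h.
have sX := supported_LU hLU.
split.
  apply: iff_trans (graded_inj_LU y1 sC hLU) _.
  exact: (graded_inj_diag y1 sX eX pX coldeg_le_rowdeg vanish_beyond).
apply: iff_trans (graded_surj_LU y1 sC hLU) _.
exact: (graded_surj_diag y eX pX vanish_beyond).
Qed.

(** Without [boundary_ok] only the minor of size [qmax1] can vanish. Elimination then stops one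
    pivot earlier, at a zero diagonal entry, and the results on a vanishing pivot apply. *)
Lemma rank_diag : (graded_inj gam N -> diag_inj y rho gam) /\
  (graded_surj rho gam N -> diag_surj y rho gam).
Proof.
have [z|nz] := eqVneq (\det (binmx k d t (maxn (d - t) qmax1))) 0; last first.
  have [m hm|[h1 _] [h2 _]] := rank_iff_diag; last by split.
  have [->//|hne] := eqVneq m (maxn (d - t) qmax1).
  by apply: minor_neq0; lia.
have dq : (d - t < qmax1)%N.
  rewrite ltnNge; apply: contra_eqN z => le.
  by rewrite (maxn_idPl le) det_binmx_small ?oner_eq0.
have nd : (qmax1.-1 < d)%N by move: dq; rewrite /qmax1; lia.
have h m : (m <= qmax1.-1)%N -> \det (binmx k d t m) != 0.
  by move=> hm; apply: minor_neq0; lia.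
have [L [U [hLU eX]]] := binmx_elimination i (ltnW nd) h.
have sX := supported_LU hLU.
pose c := Ordinal nd.
have Xc : (L *m C *m U) c c = 0.
  have := pivot_minor (q := c) hLU eX (leqnn _).
  have -> : c.+1 = maxn (d - t) qmax1 by rewrite /=; lia.
  by rewrite z => /esym/eqP; rewrite mulf_eq0 (negPf (h _ (leqnn _))) => /eqP.
have dn : vanish_from B rho gam qmax1.-1.+1.
  by have := vanish_beyond; congr (vanish_from _ _ _ _); lia.
have mono (a : 'I_d) : (c <= a)%N -> rho c <= rho a.
  by apply: rowdeg_mono; rewrite /=; lia.
have anti (a : 'I_d) : (c <= a)%N -> gam a <= gam c by rewrite /gam /coldeg; lia.
split=> H.
  apply: (graded_inj_diag_boundary y1 sX eX coldeg_le_rowdeg (c := c)) => //.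
  exact/(graded_inj_LU y1 sC hLU).
apply: (graded_surj_diag_boundary y1 eX coldeg_le_rowdeg (c := c)) => //.
exact/(graded_surj_LU y1 sC hLU).
Qed.

Lemma diag_injP : diag_inj y rho gam <->
  forall q, (d - t <= q < d)%N ->
    inj_on (gr B (i%:Z - q%:Z)) (fun b => y ^+ (2 * q + t - (d - 1)) * b).
Proof.
split=> [h q /andP[tq qd] a b ga gb e|h q v vq].
  apply/eqP; rewrite -subr_eq0; apply/eqP; apply: (h (Ordinal qd)).
    exact: memvB.
  rewrite /rho rowdeg_exp // [gam _]/(coldeg _ _) addrC addKr absz_nat.
  by rewrite mulrBr e subrr.
have [qd|tq] := ltnP q (d - t).
  by rewrite /rho rowdeg_lo // subrr mul1r.
rewrite /rho rowdeg_exp // [X in (_ - X)]/(coldeg i q) addrC addKr absz_nat => yv.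
apply: (h q) => //; [by rewrite tq ltn_ord|exact: mem0v|by rewrite mulr0].
Qed.

Lemma diag_surjP : diag_surj y rho gam <->
  forall q, (d - t <= q < d)%N ->
    surj_on (gr B (i%:Z - q%:Z)) (gr B (i%:Z + q%:Z + t%:Z - (d%:Z - 1)))
      (fun b => y ^+ (2 * q + t - (d - 1)) * b).
Proof.
split=> [h q /andP[tq qd] w wq|h q w wq].
  have [|v vq e] := h (Ordinal qd) w; first by rewrite /rho rowdeg_hi.
  exists v => //; move: e.
  by rewrite /rho rowdeg_exp // [gam _]/(coldeg _ _) addrC addKr absz_nat.
have [qd|tq] := ltnP q (d - t).
  by exists w; rewrite /rho rowdeg_lo // in wq *; rewrite subrr mul1r.
have [||v vq e] := h q _ w; first by rewrite tq ltn_ord.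
  by move: wq; rewrite /rho rowdeg_hi.
exists v => //.
by rewrite /rho rowdeg_exp // [X in (_ - X)]/(coldeg i q) addrC addKr absz_nat.
Qed.

End FullRank.

(** * The determinant *)

Lemma sqdet_size0 (R : comNzRingType) (m n : nat) (M : 'M[R]_(m, n)) :
  m = 0%N -> n = 0%N -> sqdet M = 1.
Proof. by move=> m0 n0; move: M; rewrite m0 n0 => M; rewrite sqdetE det_mx00. Qed.

Lemma eq_sum_leq (I : finType) (f g : I -> nat) :
  (forall x, f x <= g x)%N -> (\sum_x f x = \sum_x g x)%N -> f =1 g.
Proof.
move=> fg e x; apply/eqP; rewrite eqn_leq fg /=.
have : (\sum_(z | z != x) f z <= \sum_(z | z != x) g z)%N by apply: leq_sum.
move: e; rewrite (bigD1 x) //= [in RHS](bigD1 x) //=; lia.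
Qed.

Lemma big_nat_narrow (R : Type) (idx : R) (op : Monoid.com_law idx) (a b d : nat)
    (F : nat -> R) : (b <= d)%N ->
  \big[op/idx]_(a <= q < b) F q =
  \big[op/idx]_(q < d) (if (a <= q < b)%N then F q else idx).
Proof.
move=> bd; rewrite -(big_mkord predT (fun q => if (a <= q < b)%N then F q else idx)).
rewrite -big_mkcond /= (big_nat_widen _ _ _ _ _ bd) (big_nat_widenl _ 0) //=.
by apply: eq_bigl => q; rewrite andbC.
Qed.

Lemma big_nat_flip (R : Type) (idx : R) (op : Monoid.com_law idx) (P Q d : nat)
    (G : nat -> R) : (Q <= d)%N ->
  \big[op/idx]_(P <= p < Q) G p = \big[op/idx]_(d - Q <= q < d - P) G (d - q.+1)%N.
Proof.
have [QP|/ltnW PQ] := leqP Q P.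
  by rewrite !big_geq // leq_sub2l.
rewrite -(subnKC PQ); elim: (Q - P)%N => [|m IHm] md.
  by rewrite !big_geq ?addn0.
rewrite addnS big_nat_recr ?leq_addr //= IHm; last by rewrite addnS in md; apply: ltnW.
rewrite [RHS]big_ltn; last by lia.
have -> : (d - (P + m).+1).+1 = (d - (P + m))%N by lia.
by rewrite Monoid.mulmC; congr (op _ _); congr (G _); lia.
Qed.

(** Summation by parts in multiplicative form; [m a = 1] removes the boundary term at [a]. *)
Lemma prod_telescope (K : fieldType) (m : nat -> K) (g : nat -> nat) (a b : nat) :
  (a <= b)%N -> m a = 1 -> (forall q, (a <= q <= b)%N -> m q != 0) ->
  \prod_(a <= q < b.+1) (m q.+1 / m q) ^+ g q =
  m b.+1 ^+ g b * \prod_(a <= q < b) m q.+1 ^ ((g q)%:Z - (g q.+1)%:Z).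
Proof.
move=> ab m1; rewrite -(subnKC ab); elim: (b - a)%N => [|c IHc] m0.
  by rewrite addn0 big_nat1 big_geq // m1 divr1 mulr1.
rewrite addnS big_nat_recr /= ?IHc; last 2 first.
- by move=> q hq; apply: m0; lia.
- by lia.
rewrite [in RHS]big_nat_recr ?leq_addr //=.
have h : m (a + c).+1 != 0 by apply: m0; lia.
rewrite expfzDr // -exprnP -exprz_inv -exprnP expr_div_n exprVn.
ring.
Qed.

(** * The product of the pivots as F_2 F_3 *)

Section PivotProduct.
Variables (k : fieldType) (B : stdGradedArtinian k) (s d i t : nat).
Hypothesis hC : forall p,
  (maxn 1 (maxn (d - i) (i + t + 1 - s)) <= p < minn d t)%N ->
  (\det (Cmx t p d))%:~R != 0 :> k.

Let qmax1 := minn d (minn (d + s - (i + t)) (i + 1)).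
Let minor (m : nat) : k := \det (binmx k d t m).
Let gdim (q : nat) : nat := \dim (gr B (i%:Z - q%:Z)).

Let cdet (p : nat) : k := (\det (Cmx t p d))%:~R.

Lemma minor_sqr (m : nat) : (d - t <= m <= d)%N -> minor m ^+ 2 = cdet (d - m) ^+ 2.
Proof. by move=> /andP[tm md]; apply: det_binmx_sqr. Qed.

(** After telescoping, with p = d - (q + 1), the minors of size less than [qmax1] give factors of
    F_2. The fate of the last one depends on which of the three bounds defining [qmax1] is
    active. *)
Lemma pivots_product :
  (\prod_(d - t <= q < qmax1) (minor q.+1 / minor q) ^+ gdim q) ^+ 2 =
  (\prod_(maxn 1 (maxn (1 + i + t - s) (d - i - 1)) <= p < minn d t)
     cdet p ^ ((\dim (gr B (i%:Z + p%:Z - (d%:Z - 1))))%:Z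
             - (\dim (gr B (i%:Z + p%:Z - d%:Z)))%:Z) *
   (if Num.max 0 (d%:Z - 1 - i%:Z) <= i%:Z + t%:Z - s%:Z
         <= Num.min (d%:Z - 1) (t%:Z - 1)
    then cdet (i + t - s) ^+ \dim (gr B (2 * i%:Z - (d%:Z - 1) + t%:Z - s%:Z))
    else 1)) ^+ 2.
Proof.
rewrite ge_max le_min (big_nat_flip _ _ _ (geq_minl d t)).
set P0 := maxn 1 _; have -> : (d - minn d t = d - t)%N by lia.
pose F2 (b : nat) := \prod_(d - t <= q < b) minor q.+1 ^ ((gdim q)%:Z - (gdim q.+1)%:Z).
have F2E : (\prod_(d - t <= q < d - P0) cdet (d - q.+1)
    ^ ((\dim (gr B (i%:Z + (d - q.+1)%N%:Z - (d%:Z - 1))))%:Z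
       - (\dim (gr B (i%:Z + (d - q.+1)%N%:Z - d%:Z)))%:Z)) ^+ 2 = F2 (d - P0)%N ^+ 2.
  rewrite -!prodrXl; apply: eq_big_nat => q hq.
  have -> : i%:Z + (d - q.+1)%N%:Z - (d%:Z - 1) = i%:Z - q%:Z by lia.
  have -> : i%:Z + (d - q.+1)%N%:Z - d%:Z = i%:Z - q.+1%:Z by lia.
  rewrite -/(gdim _) -/(gdim _) !exprnP !exprz_exp ![_ * 2%:Z]mulrC -!exprz_exp.
  by rewrite -!exprnP minor_sqr //; lia.
rewrite [RHS]exprMn F2E.
have [qt|tq] := leqP qmax1 (d - t).
  rewrite /F2 !big_geq //; last first.
    by move: qt; rewrite /P0 /qmax1; lia.
  case: ifP => [h|_]; last by rewrite !expr1n mulr1.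
  by move: h qt; rewrite /qmax1; lia.
have [n nE] : exists n, qmax1 = n.+1 by exists qmax1.-1; lia.
rewrite nE prod_telescope; last 3 first.
- by lia.
- by rewrite /minor det_binmx_small.
- by move=> q hq; apply: (minor_neq0 hC); rewrite -/qmax1 nE; lia.
rewrite -/(F2 n) mulrC.
have mn : minor n.+1 ^+ 2 = cdet (d - n.+1) ^+ 2.
  by apply: minor_sqr; move: nE tq; rewrite /qmax1; lia.
(* Here the bound i is active: the last minor is one more factor of F_2, with the right exponent
   since [gdim n.+1] is 0, and F_3 is 1. *)
have [hP|hP] := eqVneq (d - P0)%N n.+1.
  have ni : n = i by move: hP nE; rewrite /P0 /qmax1; lia.
  rewrite ifF; last by move: hP nE; rewrite /P0 /qmax1; lia.
  rewrite hP expr1n mulr1 /F2 big_nat_recr /=; last by lia.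
  have -> : gdim n.+1 = 0%N by rewrite /gdim gr_lt0 ?dimv0 //; lia.
  by rewrite subr0.
have -> : (d - P0 = n)%N by move: hP nE; rewrite /P0 /qmax1; lia.
rewrite exprMn; congr (_ * _).
(* If the bound d - 1 is attained, the last minor belongs to p = 0 and has square 1; so does F_3 if
   it is present. *)
have [nd|nd] := eqVneq n.+1 d.
  have c1 : cdet 0 ^+ 2 = 1 by rewrite /cdet -rmorphXn /= det_Cmx0_sqr.
  rewrite -exprM mulnC exprM mn nd subnn c1 expr1n;
  case: ifP => [h|_]; last by rewrite expr1n.
  have -> : (i + t - s = 0)%N by move: h nE; rewrite /qmax1; lia.
  by rewrite -exprM mulnC exprM c1 expr1n.
(* What remains is the bound from the socle degree: the last minor belongs to p = i + t - s and
   yields F_3. *)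
rewrite ifT; last first.
  by move: hP nE tq; rewrite /P0 /qmax1; lia.
rewrite -!exprM mulnC exprM mn -exprM mulnC.
have -> : (i + t - s = d - n.+1)%N by move: hP nE; rewrite /P0 /qmax1; lia.
congr (_ ^+ (_ * 2)); rewrite /gdim; congr (\dim (gr B _)).
by move: hP nE; rewrite /P0 /qmax1; lia.
Qed.

End PivotProduct.

Section Determinant.
Variables (k : fieldType) (B : stdGradedArtinian k) (s d i t : nat).
Hypothesis d_gt0 : (0 < d)%N.
Hypothesis hs : is_socle_degree B s.
Hypothesis hC : forall p,
  (maxn 1 (maxn (d - i) (i + t + 1 - s)) <= p < minn d t)%N ->
  (\det (Cmx t p d))%:~R != 0 :> k.
Variable y : B.
Hypothesis y1 : y \in gr B 1.
Variable bas : forall j : int, (\dim (gr B j)).-tuple B.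
Hypothesis basP : forall j, basis_of (gr B j) (bas j).

Let rho := @rowdeg d t i.
Let gam := @coldeg d i.
Let C := binmx k d t d.
Let N := homog_mx y rho gam C.
Let qmax1 := minn d (minn (d + s - (i + t)) (i + 1)).
Let e (q : nat) := (2 * q + t - (d - 1))%N.

Hypothesis dim_square : forall q, (d - t <= q < qmax1)%N ->
  \dim (gr B (i%:Z - q%:Z + (e q)%:Z)) = \dim (gr B (i%:Z - q%:Z)).
Hypothesis sum_square :
  (\sum_(r < d) \dim (gr B (i%:Z + t%:Z - r%:Z)) =
     \sum_(r < d) \dim (gr B (i%:Z - r%:Z)))%N.

Lemma sum_rowdeg : (\sum_q \dim (gr B (rho q)) = \sum_q \dim (gr B (gam q)))%N.
Proof. by rewrite -sum_square [RHS](reindex_inj (@row_of_inj d t)). Qed.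

(** Past the relevant range one of the two sides is zero, which gives an inequality in the same
    direction for all indices; as [M] is square the sums agree, so equality holds termwise. *)
Lemma dim_rowdeg (q : 'I_d) : \dim (gr B (rho q)) = \dim (gr B (gam q)).
Proof.
have lt_case (a : 'I_d) : (a < maxn (d - t) qmax1)%N ->
    \dim (gr B (rho a)) = \dim (gr B (gam a)).
  move=> ha; have [ta|ta] := ltnP a (d - t); first by rewrite /rho rowdeg_lo.
  by rewrite /rho rowdeg_exp // dim_square // ta; lia.
have [dg|dr] := vanish_beyond d i t hs.
  apply/esym; move: q; apply: eq_sum_leq => [a|]; last exact/esym/sum_rowdeg.
  by have [/lt_case ->//|/dg ->] := ltnP a (maxn (d - t) qmax1); rewrite dimv0.
move: q; apply: eq_sum_leq => [a|]; last exact/sum_rowdeg.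
by have [/lt_case ->//|/dr ->] := ltnP a (maxn (d - t) qmax1); rewrite dimv0.
Qed.

Lemma dim_vanish (q : 'I_d) : (maxn (d - t) qmax1 <= q)%N ->
  \dim (gr B (rho q)) = 0%N /\ \dim (gr B (gam q)) = 0%N.
Proof.
move=> hq; have [dg|dr] := vanish_beyond d i t hs.
  by rewrite dim_rowdeg (dg q hq) dimv0.
by rewrite -dim_rowdeg (dr q hq) dimv0.
Qed.

Lemma sqdet_Mtens_sqr : let l : tens B d := tinc d y + tvar B d in
  sqdet (Mtens bas l i t) ^+ 2 = sqdet (blockcoord_mx bas rho gam N) ^+ 2.
Proof.
move=> l; rewrite -(sqdet_mxblock_rows_sqr _ (@row_of_inj d t)) //.
congr (sqdet _ ^+ 2); apply: eq_mxblock => a b; apply/matrixP => u v; rewrite !mxE.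
congr (coord _ _ _); rewrite -(@homog_mx_coefs k B d t i d_gt0).
have -> : coefs (tvar B d ^+ b * tinc d (tnth (bas (i%:Z - b%:Z)) v))
    = unitv b (tnth (bas (i%:Z - b%:Z)) v).
  by apply/colP => c; rewrite !mxE xcoef_Xinc.
by rewrite homog_mx_unitv !mxE.
Qed.

Lemma sqdet_blockcoord_mx_eliminated (n : nat) (L U : 'M[k]_d) :
  n = maxn (d - t) qmax1.-1 ->
  graded_LU rho gam L U -> eliminated n (L *m C *m U) ->
  sqdet (blockcoord_mx bas rho gam N) = \prod_(a < d)
    ((L *m C *m U) a a ^+ \dim (gr B (gam a)) *
      sqdet (coord_mx bas (rho a) (gam a) (y ^+ `|rho a - gam a|%N))).
Proof.
move=> nE hLU eX.
have sC : supported rho gam C by apply: supported_binmx.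
have -> : sqdet (blockcoord_mx bas rho gam N) =
    sqdet (blockcoord_mx bas rho gam (homog_mx y rho gam (L *m C *m U))).
  rewrite (homog_mx_LU y sC hLU) -(blockcoord_mxM y1 basP); last exact: LU_sU hLU.
  rewrite -(blockcoord_mxM y1 basP) // sqdet_mul; last exact: sum_rowdeg.
  rewrite (det_blockcoord_mx_unitrig_tr _ basP _ (LU_U hLU)) mulr1.
  by rewrite (det_blockcoord_mx_unitrig _ basP _ (LU_L hLU)) mul1r.
rewrite sqdet_mxblock_diag; last 2 first.
- exact: dim_rowdeg.
(* Of two distinct indices that are at least [n], one is at least [maxn (d - t) qmax1], so the block
   has no rows or no columns. No condition on the last pivot is required. *)
- move=> a b ab; have [/orP an|] := boolP ((a < n) || (b < n))%N.
    rewrite mxE eX //; last exact/orP.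
    by rewrite scale0r; apply/matrixP => u v; rewrite !mxE mul0r linear0.
  rewrite negb_or -!leqNgt => /andP[na nb].
  have [ha|ha] := leqP (maxn (d - t) qmax1) a.
    have [a0 _] := dim_vanish ha.
    by apply/matrixP => u; have := ltn_ord u; rewrite [X in (_ < X)%N]a0.
  have hb : (maxn (d - t) qmax1 <= b)%N.
    by move: ab; rewrite -val_eqE /=; lia.
  have [_ b0] := dim_vanish hb.
  by apply/matrixP => u v; have := ltn_ord v; rewrite [X in (_ < X)%N]b0.
apply: eq_bigr => a _; rewrite mxE coord_mxZ sqdetZ //; exact: dim_rowdeg.
Qed.

Let minor (m : nat) : k := \det (binmx k d t m).
Let gdim (q : nat) : nat := \dim (gr B (i%:Z - q%:Z)).

Lemma sqdet_Mtens_pivots : let l : tens B d := tinc d y + tvar B d in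
  sqdet (Mtens bas l i t) ^+ 2 =
    (\prod_(d - t <= q < qmax1) (minor q.+1 / minor q) ^+ gdim q *
     \prod_(d - t <= q < qmax1) sqdet (Mbar bas y (i%:Z - q%:Z) (e q))) ^+ 2.
Proof.
rewrite /= sqdet_Mtens_sqr; congr (_ ^+ 2).
have nd : (maxn (d - t) qmax1.-1 <= d)%N by rewrite /qmax1; lia.
have minors := minor_neq0 hC.
have [L [U [hLU eX]]] := binmx_elimination i nd minors.
rewrite (sqdet_blockcoord_mx_eliminated _ hLU eX) // -big_split /=.
rewrite (big_nat_narrow _ _ _ (geq_minl _ _ : (qmax1 <= d)%N)).
apply: eq_bigr => a _; case: ifP => ha.
  have [ta aq] := andP ha; congr (_ ^+ _ * _); last first.
    by rewrite /rho rowdeg_exp // [gam a]/(i%:Z - a%:Z) addrC addKr absz_nat.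
  have an : (a <= maxn (d - t) qmax1.-1)%N by lia.
  by rewrite /minor (pivot_minor hLU eX an) mulrAC divff ?mul1r ?minors.
(* For a < d - t the pivot is 1 and the block is an identity matrix; beyond the range the blocks are
   empty. *)
have [ta|ta] := ltnP a (d - t).
  have an : (a <= maxn (d - t) qmax1.-1)%N by lia.
  have := pivot_minor hLU eX an; rewrite !det_binmx_small ?(ltnW ta) // mul1r => <-.
  by rewrite expr1n mul1r /rho rowdeg_lo // subrr expr0 coord_mx1 // sqdetE det1.
have [r0 g0] := @dim_vanish a ltac:(lia).
by rewrite sqdet_size0 // g0 expr0 mul1r.
Qed.

End Determinant.

(** The open set is the whole space, cut out by the constant polynomial 1. *)
Lemma for_general_all (k : fieldType) (B : stdGradedArtinian k) (V : {vspace B})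
  (P : B -> Prop) : (forall v, v \in V -> P v) -> for_general V P.
Proof.
move=> h; exists (fun=> True); split; last by move=> v vV _; apply: h.
  exists (fun f => f = 1) => v _; split=> // _.
  by exists 1 => //; rewrite rmorph1 oner_eq0.
by exists 0; rewrite ?mem0v.
Qed.

Theorem theorem3p6 (k : fieldType) (B : stdGradedArtinian k) (s d i t : nat)
  (hs : is_socle_degree B s) (hd : (1 <= d)%N)
  (hchar : [pchar k] =i pred0 \/
     exists2 c : nat, c \in [pchar k] &
       ~~ (c%:Z %| \prod_(maxn 1 (maxn (d - i) (i + t + 1 - s)) <= p < minn d t)
                     \det (Cmx t p d))%Z) :
  for_general (gr B 1) (fun lbar : B =>
    let l : tens B d := tinc d lbar + tvar B d in
    let full_rank_A :=
      full_rank (@tgr k B d i%:Z) (@tgr k B d (i%:Z + t%:Z)) (fun a => l ^+ t * a) in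
    let inrange (q : nat) := (d - t <= q < d)%N in
    let src (q : nat) := gr B (i%:Z - q%:Z) in
    let tgt (q : nat) := gr B (i%:Z + q%:Z + t%:Z - (d%:Z - 1)) in
    let e (q : nat) := (2 * q + t - (d - 1))%N in
    let full_rank_B :=
      (forall q, inrange q -> inj_on (src q) (fun b => lbar ^+ e q * b)) \/
      (forall q, inrange q -> surj_on (src q) (tgt q) (fun b => lbar ^+ e q * b)) in
    let qmax1 := minn d (minn (d + s - (i + t)) (i + 1)) in
    [/\ full_rank_A -> full_rank_B,
        boundary_ok k s d i t -> full_rank_B -> full_rank_A
      & forall bas : (forall j : int, (\dim (gr B j)).-tuple B),
        (forall j, basis_of (gr B j) (bas j)) ->
        (forall q, (d - t <= q < qmax1)%N ->
           \dim (gr B (i%:Z - q%:Z + (e q)%:Z)) = \dim (gr B (i%:Z - q%:Z))) ->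
        (\sum_(r < d) \dim (gr B (i%:Z + t%:Z - r%:Z)) =
           \sum_(r < d) \dim (gr B (i%:Z - r%:Z)))%N ->
        let F1 := \prod_(d - t <= q < qmax1)
          sqdet (Mbar bas lbar (i%:Z - q%:Z) (e q)) in
        let F2 := \prod_(maxn 1 (maxn (1 + i + t - s) (d - i - 1)) <= p < minn d t)
          ((\det (Cmx t p d))%:~R : k) ^
            ((\dim (gr B (i%:Z + p%:Z - (d%:Z - 1))))%:Z
             - (\dim (gr B (i%:Z + p%:Z - d%:Z)))%:Z) in
        let F3 :=
          if Num.max 0 (d%:Z - 1 - i%:Z) <= i%:Z + t%:Z - s%:Z
               <= Num.min (d%:Z - 1) (t%:Z - 1)
          then ((\det (Cmx t (i + t - s) d))%:~R : k) ^+
                 \dim (gr B (2 * i%:Z - (d%:Z - 1) + t%:Z - s%:Z))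
          else 1 in
        let detM := sqdet (Mtens bas l i t) in
        detM = F1 * F2 * F3 \/ detM = - (F1 * F2 * F3)]).
Proof.
have hC p : (maxn 1 (maxn (d - i) (i + t + 1 - s)) <= p < minn d t)%N ->
    (\det (Cmx t p d))%:~R != 0 :> k.
  by apply: det_Cmx_pchar => //; rewrite geq_min leqnSn orbT.
apply: for_general_all => y y1; split.
- have [Hinj Hsurj] := rank_diag hs hC y1.
  case=> [/(tens_inj t i hd)/Hinj/diag_injP|/(tens_surj t i hd)/Hsurj/diag_surjP].
    by left.
  by right.
- move=> hb; have minors m := @minor_neq0_boundary _ _ _ _ _ hC m hb.
  have [Hinj Hsurj] := rank_iff_diag hs y1 minors.
  case=> [/diag_injP/Hinj/(tens_inj t i hd)|/diag_surjP/Hsurj/(tens_surj t i hd)].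
    by left.
  by right.
(* In a field, equality up to sign is equality of squares. *)
move=> bas basP hdim hsum F1 F2 F3 detM; apply/pred2P; rewrite -eqf_sqr; apply/eqP.
have := sqdet_Mtens_pivots hd hs hC y1 basP hdim hsum; rewrite /= -/detM => ->.
rewrite exprMn (pivots_product B hC) -exprMn; congr (_ ^+ 2).
by rewrite mulrC mulrA.
Qed.
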